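(* Let $G$ be a metrizable locally compact $E$-group with identity $e$ and let $T\subseteq G$ be an $E$-set. Then $T$ is an approximable $\mathcal{WAP}(G)$-interpolation set if and only if $T$ is right uniformly discrete with respect to some neighbourhood $V$ of $e$ such that $VT$ is translation-compact.
   Context: $\mathcal{WAP}(G)$ is the algebra of weakly almost periodic functions: bounded continuous $f:G\to\mathbb C$ whose set of left translates $f_s(t)=f(st)$ is relatively weakly compact in the Banach space of bounded continuous functions on $G$. $T\subseteq G$ is an approximable $\mathcal{WAP}(G)$-interpolation set if every bounded $f:T\to\mathbb C$ extends to a function in $\mathcal{WAP}(G)$ and, for every neighbourhood $N$ of $e$, there are open neighbourhoods $V_1,V_2$ of $e$ with $\overline{V_1}\subseteq V_2\subseteq N$ such that for each $T_1\subseteq T$ there is $h\in\mathcal{WAP}(G)$ with $h(V_1T_1)\subseteq\{1\}$ and $h(G\setminus V_2T_1)\subseteq\{0\}$. $T$ is right uniformly discrete with respect to $V$ if $Vs\cap Vs'=\emptyset$ for all $s\ne s'$ in $T$. A set $S\subseteq G$ is right translation-compact if every non-relatively compact $L\subseteq G$ contains a finite subset $F$ such that $\bigcap_{b\in F}b^{-1}S$ is relatively compact; left translation-compact if the same holds with $\bigcap_{b\in F}Sb^{-1}$; translation-compact if both. For $G$ non-compact, an $E$-set is a non-relatively compact $T\subseteq G$ such that for each neighbourhood $N$ of $e$, $\bigcap\{t^{-1}Nt:t\in T\cup T^{-1}\}$ is a neighbourhood of $e$. $G$ is an $E$-group if it is non-compact and contains an $E$-set. *)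

(* Defs.v *)
From HB Require Import structures.
From mathcomp Require Import all_boot all_order all_algebra complex.
From mathcomp Require Import boolp classical_sets functions cardinality reals.
From mathcomp Require Import topology normedtype.

Set Implicit Arguments.
Unset Strict Implicit.
Unset Printing Implicit Defensive.

Import Order.TTheory GRing.Theory Num.Theory.
Import numFieldNormedType.Exports.

Local Open Scope classical_set_scope.
Local Open Scope ring_scope.

HB.structure Definition PreTopologicalGroup := {G of Topological G & Group G}.

HB.mixin Record PreTopologicalGroup_isTopologicalGroup G
    & PreTopologicalGroup G := {
  mulg_continuous : continuous (fun x : G * G => (x.1 * x.2)%g) ;
  invg_continuous : continuous (fun x : G => (x^-1)%g)
}.

#[short(type="topologicalGroupType")]
HB.structure Definition TopologicalGroup :=
  {G of PreTopologicalGroup G & PreTopologicalGroup_isTopologicalGroup G}.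

Definition metrizable (R : realType) (T : topologicalType) : Prop :=
  exists d : T -> T -> R,
    [/\ forall x y, d x y = 0 <-> x = y,
        forall x y, d x y = d y x,
        forall x y z, d x z <= d x y + d y z &
        forall (x : T) (A : set T),
          nbhs x A <-> exists2 r : R, 0 < r & [set y | d x y < r] `<=` A].

Section WeakTopology.
Context {K : numFieldType} (V : normedModType K).

Definition dual : Type := {phi : {linear V -> K^o} | continuous phi}.

(* The coarsest topology making every element of the dual continuous. *)
Definition weak : Type :=
  sup_topology (fun phi : dual =>
    Topological.on (initial_topology (sval phi : V -> K^o))).

HB.instance Definition _ := Topological.on weak.

Definition relatively_weakly_compact (A : set V) : Prop :=
  precompact (A : set weak).

End WeakTopology.

Section BoundedContinuous.
Context (R : realType) (T : topologicalType).
Local Notation C := (R[i]^o).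

Definition bcont : {pred (T -> C)} :=
  mem [set f : T -> C | continuous f /\ bounded_fun f].

Record bcontType := BCont {
  bcont_fun :> T -> C ;
  bcont_funP : bcont_fun \in bcont
}.

HB.instance Definition _ := [isSub for bcont_fun].
HB.instance Definition _ := [Choice of bcontType by <:].

Lemma Re_normM (a b : R[i]) :
  complex.Re (`|a| * `|b|) = complex.Re `|a| * complex.Re `|b|.
Proof. by rewrite !normc_def/= mul0r subr0. Qed.

Lemma Re_norm_ge0 (a : R[i]) : 0 <= complex.Re `|a|.
Proof. by rewrite normc_def/= sqrtr_ge0. Qed.

Lemma Re_normD (a b : R[i]) :
  complex.Re `|a + b| <= complex.Re `|a| + complex.Re `|b|.
Proof. by have := ler_normD a b; rewrite lecE => /andP[_]; rewrite raddfD. Qed.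

Lemma bcontP (f : T -> C) :
  f \in bcont <-> continuous f /\ bounded_fun f.
Proof. by split=> [/set_mem|] //; move=> ?; apply/mem_set. Qed.

Lemma bounded_funCP (f : T -> C) :
  bounded_fun f <-> exists M : R, forall x, complex.Re `|f x| <= M.
Proof.
split=> [[M [Mreal /(_ (M + 1))]]|[M fM]].
  rewrite ltrDl ltr01 => /(_ isT) fM; exists (complex.Re (M + 1)) => x.
  by have := fM x I; rewrite /= lecE => /andP[].
exists (M%:C)%C; split; first by rewrite complex_real.
move=> N MN x _; apply: le_trans (ltW MN).
by rewrite lecE/= fM andbT.
Qed.

Lemma bcont_submod_closed : submod_closed bcont.
Proof.
split=> [|a f g /bcontP[cf bf] /bcontP[cg bg]]; apply/bcontP; split.
- exact: cst_continuous.
- by apply/bounded_funCP; exists 0 => x; rewrite normr0.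
- move=> x; apply: cvgD; last exact: cg.
  by apply: cvgZr; exact: cf.
- move/bounded_funCP: bf => [M fM]; move/bounded_funCP: bg => [N gN].
  apply/bounded_funCP; exists (complex.Re `|a| * M + N) => x.
  apply: le_trans (Re_normD _ _) _; rewrite lerD//.
  rewrite normrM.
  by rewrite Re_normM ler_wpM2l ?Re_norm_ge0.
Qed.

HB.instance Definition _ := GRing.isSubmodClosed.Build _ _ bcont
  bcont_submod_closed.
HB.instance Definition _ := [SubChoice_isSubLmodule of bcontType by <:].

(* `|f x| and the norm below live in R[i], as required of a normed space over
   R[i]; the supremum is taken in R. *)
Definition bcont_norm (f : bcontType) : R[i] :=
  (sup [set complex.Re `|f x| | x in [set: T]])%:C%C.

Lemma bcont_norm_ub (f : bcontType) (x : T) :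
  complex.Re `|f x| <= complex.Re (bcont_norm f).
Proof.
have /bcontP[_ /bounded_funCP[M fM]] := bcont_funP f.
by apply: ub_le_sup; [exists M => _ [y _ <-]|exists x].
Qed.

Lemma bcont_norm_le (f : bcontType) (M : R) :
  0 <= M -> (forall x, complex.Re `|f x| <= M) -> bcont_norm f <= (M%:C)%C.
Proof.
move=> M0 fM; rewrite /bcont_norm lecR.
have [->|/set0P ne] := eqVneq [set complex.Re `|f x| | x in [set: T]] set0.
  by rewrite sup0.
by apply: ge_sup => // _ [x _ <-].
Qed.

Lemma bcont_norm_ge0 (f : bcontType) : 0 <= complex.Re (bcont_norm f).
Proof.
have [e|/set0P[_ [x _ _]]] := eqVneq [set complex.Re `|f x| | x in [set: T]] set0.
  by rewrite /bcont_norm e sup0.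
exact: le_trans (Re_norm_ge0 _) (bcont_norm_ub f x).
Qed.

Lemma bcont_normE (f : bcontType) :
  bcont_norm f = (complex.Re (bcont_norm f))%:C%C.
Proof. by []. Qed.

Lemma bcont_normD (f g : bcontType) :
  bcont_norm (f + g) <= bcont_norm f + bcont_norm g.
Proof.
rewrite [X in _ <= X + _]bcont_normE [X in _ <= _ + X]bcont_normE -rmorphD.
apply: bcont_norm_le => [|x]; first by rewrite addr_ge0 ?bcont_norm_ge0.
by apply: le_trans (Re_normD _ _) _; rewrite lerD ?bcont_norm_ub.
Qed.

Lemma bcont_normZ_le (a : R[i]) (f : bcontType) :
  bcont_norm (a *: f) <= `|a| * bcont_norm f.
Proof.
have -> : `|a| * bcont_norm f =
    (complex.Re `|a| * complex.Re (bcont_norm f))%:C%C.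
  by rewrite rmorphM; congr (_ * _); rewrite normc_def.
apply: bcont_norm_le => [|x]; first by rewrite mulr_ge0 ?bcont_norm_ge0 ?Re_norm_ge0.
rewrite [X in `|X|](_ : _ = a * f x)// normrM Re_normM.
by rewrite ler_wpM2l ?Re_norm_ge0 ?bcont_norm_ub.
Qed.

Lemma bcont_normZ (a : R[i]) (f : bcontType) :
  bcont_norm (a *: f) = `|a| * bcont_norm f.
Proof.
apply/le_anti; rewrite bcont_normZ_le/=.
have [->|a0] := eqVneq a 0.
  by rewrite normr0 mul0r bcont_normE lecR bcont_norm_ge0.
rewrite -[f in leLHS](scalerK a0) -ler_pdivlMl ?normr_gt0//.
by rewrite -normfV bcont_normZ_le.
Qed.

Lemma bcont_norm0_eq0 (f : bcontType) : bcont_norm f = 0 -> f = 0.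
Proof.
move=> f0; apply/val_inj/funext => x.
have fx0 : complex.Re `|f x| <= 0 by have := bcont_norm_ub f x; rewrite f0.
have nE : `|f x : R[i]| = (complex.Re `|f x|)%:C%C by rewrite normc_def.
apply: (@normr0_eq0 _ R[i]); rewrite nE.
by congr (_%:C)%C; apply/le_anti; rewrite fx0 Re_norm_ge0.
Qed.

HB.instance Definition _ := Lmodule_isNormed.Build R[i] bcontType
  bcont_normD bcont_normZ bcont_norm0_eq0.

End BoundedContinuous.


Section TopologicalGroupNotions.
Context (G : topologicalGroupType).

Definition mulset (A B : set G) : set G := [set (a * b)%g | a in A & b in B].

Definition invset (A : set G) : set G := [set (a^-1)%g | a in A].

Definition right_uniformly_discrete (V T : set G) : Prop :=
  forall s s', T s -> T s' -> s <> s' ->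
    mulset V [set s] `&` mulset V [set s'] = set0.

Definition right_translation_compact (S : set G) : Prop :=
  forall L : set G, ~ precompact L ->
    exists F : set G, [/\ finite_set F, F `<=` L &
      precompact (\bigcap_(b in F) mulset [set (b^-1)%g] S)].

Definition left_translation_compact (S : set G) : Prop :=
  forall L : set G, ~ precompact L ->
    exists F : set G, [/\ finite_set F, F `<=` L &
      precompact (\bigcap_(b in F) mulset S [set (b^-1)%g])].

Definition translation_compact (S : set G) : Prop :=
  right_translation_compact S /\ left_translation_compact S.

Definition E_set (T : set G) : Prop :=
  ~ precompact T /\
  forall N : set G, nbhs (1%g : G) N ->
    nbhs (1%g : G)
      (\bigcap_(t in T `|` invset T) mulset [set (t^-1)%g] (mulset N [set t])).

Definition E_group : Prop :=
  ~ compact [set: G] /\ exists T : set G, E_set T.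

End TopologicalGroupNotions.

Section WeaklyAlmostPeriodic.
Context (R : realType) (G : topologicalGroupType).
Local Notation C := (R[i]^o).
Local Notation CB := (bcontType R G).

Lemma left_translate_bcont (s : G) (f : CB) :
  (fun t => f (s * t)%g : C) \in @bcont R G.
Proof.
have /bcontP[cf /bounded_funCP[M fM]] := bcont_funP f.
apply/bcontP; split; last by apply/bounded_funCP; exists M => x; exact: fM.
move=> t; apply: (@continuous_comp _ _ _ (fun t => (s * t)%g) f); last exact: cf.
apply: (@continuous_comp _ _ _ (fun t => (s, t)) (fun x => (x.1 * x.2)%g)).
  by apply: cvg_pair => //=; exact: cvg_cst.
exact: mulg_continuous.
Qed.

Definition left_translate (s : G) (f : CB) : CB :=
  BCont (left_translate_bcont s f).

Definition WAP : set CB :=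
  [set f | relatively_weakly_compact [set left_translate s f | s in [set: G]]].

Definition approximable_WAP_interpolation_set (T : set G) : Prop :=
  (forall f : T -> C, bounded_fun f ->
     exists2 g : CB, WAP g & forall t : T, g (val t) = f t) /\
  (forall N : set G, nbhs (1%g : G) N ->
     exists V1 V2 : set G,
       [/\ open_nbhs (1%g : G) V1, open_nbhs (1%g : G) V2,
           closure V1 `<=` V2, V2 `<=` N &
           forall T1 : set G, T1 `<=` T ->
             exists h : CB, [/\ WAP h,
               h @` mulset V1 T1 `<=` [set 1] &
               h @` (~` mulset V2 T1) `<=` [set 0]]]).

End WeaklyAlmostPeriodic.

(* Main.v *)
From HB Require Import structures.
Require Import Defs.
From mathcomp Require Import all_boot all_order all_algebra complex.
From mathcomp Require Import boolp classical_sets functions cardinality reals.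
From mathcomp Require Import topology normedtype.
From mathcomp Require Import ring lra.

(**
  Necessity. Limits of evaluations along ultrafilters are functionals on the
  space of bounded continuous functions, so a WAP function [f] satisfies
  Grothendieck's double limit condition.  If [V1 T] were not translation-compact,
  one could choose sequences such that the function [h] attached to a suitable
  [T1] is [1] on [s_i x_j] for [i < j] and [0] for [i > j], against the double
  limit condition.  If [T] were not right uniformly discrete, there would be
  pairs [s_n], [v_n s_n] in [T] with [v_n] tending to the identity and a WAP
  function equal to [0] on the former and [1] on the latter; partial products
  of the [v_n] again violate the double limit condition.

  Sufficiency. The interpolating functions are [f(x) = c_t phi(x t^-1)] on [V t],
  with [phi] a bump at the identity; the E-set condition makes them uniformly
  continuous on both sides.  To see that [f] is WAP, it is enough that for each
  ultrafilter on [G] the translates [f_s] converge weakly along it.  When the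
  ultrafilter converges, uniform continuity gives norm convergence.  Otherwise
  [f_s] converges locally uniformly to some [g], which has relatively compact
  support by left translation-compactness.  If a functional [phi] separates [f_s]
  from [g] along the ultrafilter, then the total variation of [phi] charges all
  the [|f_s|] uniformly outside every compact set, and an argument in the style
  of Ptak's lemma gives a sequence [s_n] leaving compact sets such that no finite
  product of the [|f_(s_n)|] has relatively compact support, against right
  translation-compactness.
*)

Set Implicit Arguments.
Unset Strict Implicit.
Unset Printing Implicit Defensive.

Import Order.TTheory GRing.Theory Num.Theory.
Import numFieldNormedType.Exports.

Local Open Scope classical_set_scope.
Local Open Scope ring_scope.

(** * Sequences chosen with memory, ultrafilters and the complex modulus *)

Section Sequences.
Context (X : Type).

Lemma in_history (y : nat -> X) m n : (m < n)%N ->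
  List.In (y m) (rev (mkseq y n)).
Proof.
elim: n => // n IH; rewrite ltnS mkseqS rev_rcons => mn.
have [->|mneq] := eqVneq m n; first by left.
by right; apply: IH; rewrite ltn_neqAle mneq.
Qed.

(** The recursion runs on histories bundled with a proof of [good], which makes [step] applicable
    again; [rev] puts the latest term first, matching [y :: l]. *)
Lemma dependent_choice_history (good : seq X -> Prop) (P : seq X -> X -> Prop) :
  good [::] -> (forall l, good l -> exists y, good (y :: l) /\ P l y) ->
  exists y : nat -> X, forall n,
    good (rev (mkseq y n)) /\ P (rev (mkseq y n)) (y n).
Proof.
move=> good0 step.
have [nx nxP] : {nx : {l | good l} -> X &
    forall l, good (nx l :: sval l) /\ P (sval l) (nx l)}.
  by apply: (@choice _ _ (fun l y => good (y :: sval l) /\ P (sval l) y)) => -[l];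
    exact: step.
pose st := fix st n : {l | good l} := if n is m.+1
  then exist _ (nx (st m) :: sval (st m)) (nxP (st m)).1 else exist _ [::] good0.
have stE n : sval (st n) = rev (mkseq (nx \o st) n).
  by elim: n => // n IH; rewrite mkseqS rev_rcons -IH.
exists (nx \o st) => n; rewrite -stE; split; first exact: (svalP (st n)).
exact: (nxP (st n)).2.
Qed.

End Sequences.

Lemma near_In (X Y : Type) (F : set_system Y) (l : seq X) (A : X -> Y -> Prop) :
  Filter F -> (forall a, List.In a l -> \forall y \near F, A a y) ->
  \forall y \near F, forall a, List.In a l -> A a y.
Proof.
move=> FF; elim: l => [|b l IH] H; first by apply: filterE => y a [].
have Hl := IH (fun a al => H a (or_intror al)).
by apply: filterS2 (H b (or_introl erefl)) Hl => y Ab Al a [<-|/Al].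
Qed.

Section Ultrafilters.

Lemma ultra_notP T (U : set_system T) (A : set T) : UltraFilter U ->
  ~ U A -> U (~` A).
Proof. by move=> UU nA; have [] := in_ultra_setVsetC A UU. Qed.

Lemma fmap_ultra T S (f : T -> S) (U : set_system T) : UltraFilter U ->
  UltraFilter (f @ U).
Proof.
move=> UU; split; first exact: _.
move=> H HF sub; rewrite predeqE => A; split; last exact: sub.
move=> HA; apply: contrapT => /(ultra_notP UU) nA.
by have /filter_ex[x []] : H (A `&` ~` A) by apply: filterI => //; apply: sub.
Qed.

Lemma ultra_bounded_cvg (R : realType) T (U : set_system T) (f : T -> R) (M : R) :
  UltraFilter U -> (forall x, `|f x| <= M) -> cvg (f @ U).
Proof.
move=> UU fM; have UfU := fmap_ultra f UU.
have := @segment_compact R (- M) M; rewrite compact_ultra => /(_ _ UfU) [|l [_ fl]].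
  by rewrite fmapE; apply: filterE => x; rewrite /= in_itv/= -ler_norml.
by apply/cvg_ex; exists l.
Qed.

Lemma exists_free_ultra : exists2 U : set_system nat, UltraFilter U & \oo `<=` U.
Proof. by have [U [UU sU]] := ultraFilterLemma eventually_filter; exists U. Qed.

End Ultrafilters.

Section Modulus.
Context (R : realType).
Local Notation C := (R[i]^o).
Implicit Types z w : R[i].

Definition cmod z : R := complex.Re `|z|.

Lemma cmodE z : `|z| = (cmod z)%:C%C.
Proof. by rewrite /cmod normc_def. Qed.

Lemma cmod_ge0 z : 0 <= cmod z. Proof. exact: Re_norm_ge0. Qed.

Lemma cmodD z w : cmod (z + w) <= cmod z + cmod w. Proof. exact: Re_normD. Qed.

Lemma cmodM z w : cmod (z * w) = cmod z * cmod w.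
Proof. by rewrite /cmod normrM Re_normM. Qed.

Lemma cmod0 : cmod 0 = 0. Proof. by rewrite /cmod normr0. Qed.

Lemma cmodN z : cmod (- z) = cmod z. Proof. by rewrite /cmod normrN. Qed.

Lemma cmodB z w : cmod (z - w) = cmod (w - z).
Proof. by rewrite -cmodN opprB. Qed.

Lemma cmod_real (x : R) : cmod x%:C%C = `|x|.
Proof. by rewrite /cmod normc_def/= expr0n addr0 sqrtr_sqr. Qed.

Lemma cmod1 : cmod 1 = 1.
Proof. by rewrite (cmod_real 1) normr1. Qed.

Lemma cmod_eq0 z : cmod z = 0 -> z = 0.
Proof. by move=> z0; apply: (@normr0_eq0 _ R[i]); rewrite cmodE z0. Qed.

Lemma cmod_tri w z1 z2 : cmod (z1 - z2) <= cmod (z1 - w) + cmod (w - z2).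
Proof. by rewrite -[X in cmod X](_ : z1 - w + (w - z2) = _) ?cmodD// addrA subrK. Qed.

Lemma cmod_dist z w : `|cmod z - cmod w| <= cmod (z - w).
Proof.
rewrite ler_norml; apply/andP; split.
  by have := cmodD (w - z) z; rewrite subrK (cmodB w); lra.
by have := cmodD (z - w) w; rewrite subrK; lra.
Qed.

Lemma Re_le_cmod z : `|complex.Re z| <= cmod z.
Proof.
case: z => a b; rewrite /cmod normc_def/= -sqrtr_sqr ler_sqrt ?addr_ge0 ?sqr_ge0//.
by rewrite lerDl sqr_ge0.
Qed.

Lemma Im_le_cmod z : `|complex.Im z| <= cmod z.
Proof.
case: z => a b; rewrite /cmod normc_def/= -sqrtr_sqr ler_sqrt ?addr_ge0 ?sqr_ge0//.
by rewrite lerDr sqr_ge0.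
Qed.

Lemma cmod_le_ReIm z : cmod z <= `|complex.Re z| + `|complex.Im z|.
Proof.
case: z => a b.
have -> : (a +i* b)%C = (a%:C + 'i * b%:C)%C by rewrite [LHS]complexE.
rewrite (le_trans (cmodD _ _))// cmodM !cmod_real/=.
have -> : cmod 'i%C = 1 by rewrite /cmod normc_def/= expr0n add0r expr1n sqrtr1.
by rewrite mul1r !mulr0 !mul0r !subr0 !add0r !addr0 mul1r.
Qed.

Lemma cvgC_cmodP T (F : set_system T) (f : T -> C) (l : C) : Filter F ->
  f @ F --> l <-> forall e : R, 0 < e -> \forall x \near F, cmod (f x - l) < e.
Proof.
move=> FF; split=> [/cvgrPdist_lt fl e e0|fl].
  have e0' : 0 < e%:C%C by rewrite ltcR.
  by apply: filterS (fl _ e0') => x /=; rewrite distrC cmodE ltcR.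
(* Positivity in [R[i]] forces the imaginary part of the tolerance to vanish, so real tolerances
   suffice. *)
apply/cvgrPdist_lt => -[e e'] /[dup]; rewrite {1}ltcE/= => /andP[/eqP -> e0] _.
by apply: filterS (fl _ e0) => x; rewrite distrC cmodE ltcR.
Qed.

Lemma cvgC_unique T (F : set_system T) (f : T -> C) (l l' : C) {FF : ProperFilter F} :
  f @ F --> l -> f @ F --> l' -> l = l'.
Proof. by apply: cvg_unique; exact: norm_hausdorff. Qed.

Lemma ultra_bounded_cvgC T (U : set_system T) (f : T -> C) (M : R) :
  UltraFilter U -> (forall x, cmod (f x) <= M) -> cvg (f @ U).
Proof.
move=> UU fM.
have /cvg_ex[/= a fa] := @ultra_bounded_cvg R T U (fun x => complex.Re (f x)) M UU
  (fun x => le_trans (Re_le_cmod _) (fM x)).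
have /cvg_ex[/= b fb] := @ultra_bounded_cvg R T U (fun x => complex.Im (f x)) M UU
  (fun x => le_trans (Im_le_cmod _) (fM x)).
apply/cvg_ex; exists (a +i* b)%C; apply/cvgC_cmodP => e e0.
have e2 : 0 < e / 2 by lra.
move/cvgrPdist_lt : fa => /(_ _ e2) fa; move/cvgrPdist_lt : fb => /(_ _ e2) fb.
apply: filterS2 fa fb => x /= fa fb; apply: le_lt_trans (cmod_le_ReIm _) _.
rewrite [X in _ < X](splitr e) ltrD//.
  by case: (f x) fa => u v /=; rewrite distrC.
by case: (f x) fb => u v /=; rewrite distrC.
Qed.

Lemma cvgC_le T (F : set_system T) (f : T -> C) (l c : C) (e : R)
  {FF : ProperFilter F} : f @ F --> l -> (\forall x \near F, cmod (f x - c) <= e) ->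
  cmod (l - c) <= e.
Proof.
move=> /cvgC_cmodP fl fe; apply/ler_addgt0Pr => d d0.
have [x [fx fx']] := filter_ex (filterI (fl _ d0) fe).
by rewrite (le_trans (cmod_tri (f x) _ _))// addrC lerD// cmodB ltW.
Qed.

Lemma cvgC_ge T (F : set_system T) (f : T -> C) (l c : C) (e : R)
  {FF : ProperFilter F} : f @ F --> l -> (\forall x \near F, e <= cmod (f x - c)) ->
  e <= cmod (l - c).
Proof.
move=> /cvgC_cmodP fl fe; apply/ler_addgt0Pr => d d0.
have [x [fx fx']] := filter_ex (filterI (fl _ d0) fe).
by rewrite (le_trans fx')// (le_trans (cmod_tri l _ _))// addrC lerD// ltW.
Qed.

End Modulus.

(** * Weak convergence of translates *)

Lemma cvg_initialP (S : choiceType) (T : topologicalType) (f : S -> T)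
    (F : set_system S) (s : S) : Filter F ->
  F --> (s : initial_topology f) <-> f @ F --> f s.
Proof.
move=> FF; split=> [Fs A /= nA|Fs A [_ [[B oB <-] Bfs] BA]].
  by apply: Fs; exact: (@initial_continuous _ _ f s _ nA).
by apply: filterS BA _; apply: Fs; exact: open_nbhs_nbhs.
Qed.

Lemma weak_cvgP (K : numFieldType) (V : normedModType K) (F : set_system V)
    (v : V) : Filter F ->
  F --> (v : weak V) <-> forall phi : dual V, sval phi @ F --> (sval phi v : K^o).
Proof.
move=> FF; split=> [/cvg_sup Fv phi|Fv].
  by apply/cvg_initialP; exact: (Fv phi).
by apply/cvg_sup => phi; apply/cvg_initialP; exact: Fv.
Qed.

Section Translations.
Context (G : topologicalGroupType).

Lemma mulg_continuousl (y : G) : continuous (fun x => (x * y)%g).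
Proof.
move=> x; apply: (@continuous_comp _ _ _ (fun t => (t, y)) (fun x => (x.1 * x.2)%g)).
  by apply: cvg_pair => //=; exact: cvg_cst.
exact: mulg_continuous.
Qed.

Lemma mulg_continuousr (y : G) : continuous (fun x => (y * x)%g).
Proof.
move=> x; apply: (@continuous_comp _ _ _ (fun t => (y, t)) (fun x => (x.1 * x.2)%g)).
  by apply: cvg_pair => //=; exact: cvg_cst.
exact: mulg_continuous.
Qed.

End Translations.

Section WeakLimits.
Context (R : realType) (G : topologicalGroupType).
Local Notation C := (R[i]^o).
Local Notation CB := (bcontType R G).
Implicit Types (f g : CB).

Lemma bcont_bounded f : exists2 M : R, 0 < M & forall x, cmod (f x) <= M.
Proof.
exists (cmod `|f| + 1) => [|x]; first by rewrite ltr_wpDl// cmod_ge0.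
have := bcont_norm_ub f x; rewrite /cmod -/(`|f|) => /le_trans; apply.
by rewrite -[leLHS]addr0 lerD// normc_def/= expr0n/= addr0 sqrtr_sqr ler_norm.
Qed.

Lemma bcont_continuous f : continuous (f : G -> C).
Proof. by have /bcontP[] := bcont_funP f. Qed.

Lemma bcont_norm_le_real f (e : R) : 0 < e -> (forall x, cmod (f x) <= e) ->
  `|f| <= e%:C%C.
Proof. by move=> e0 fe; apply: bcont_norm_le => //; exact: ltW. Qed.

Lemma bcont_exists (f : G -> C) (M : R) : continuous f ->
  (forall x, cmod (f x) <= M) -> exists g : CB, forall x, g x = f x.
Proof.
move=> cf fM; have bf : f \in @bcont R G.
  by apply/bcontP; split=> //; apply/bounded_funCP; exists M.
by exists (BCont bf).
Qed.

Lemma dual_bound (phi : dual CB) : exists2 B : R, 0 < B &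
  forall g (r : R), 0 < r -> (forall x, cmod (g x) <= r) ->
    cmod (sval phi g) <= B * r.
Proof.
have /linear_bounded_continuous/linear_boundedP := svalP phi.
move=> /pinfty_ex_gt0[[B B']]; rewrite ltcE/= => /andP[/eqP-> B0] H.
exists B => // g r r0 gr.
have := H g; rewrite cmodE => /le_trans /(_ (ler_wpM2l _ (bcont_norm_le_real r0 gr))).
by rewrite lecR ltW// => /(_ isT); rewrite lecE/= !mul0r subr0 => /andP[].
Qed.

Section LimitFunctional.
Context (J : Type) (V : set_system J) (x : J -> G).

(** Boundedness gives every [f] a limit along the ultrafilter [V]; the resulting functional has norm
    at most 1 and can be applied to weak limits. *)
Definition lim_eval (VU : UltraFilter V) (f : CB) : C :=
  lim ((f (x j) : C) @[j --> V]).

Context (VU : UltraFilter V).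

Lemma lim_eval_cvg f : (f (x j) : C) @[j --> V] --> (lim_eval VU f : C).
Proof.
have [M _ fM] := bcont_bounded f.
by apply: (@ultra_bounded_cvgC _ _ _ (fun j => f (x j)) M VU) => j; exact: fM.
Qed.

Arguments lim_eval_cvg : clear implicits.

Lemma lim_eval_linear : linear (lim_eval VU).
Proof.
move=> a f g; apply: (cvgC_unique (lim_eval_cvg _)).
apply: (@cvgD _ C _ V _ (fun j => a *: (f (x j) : C)) (fun j => g (x j) : C)).
  by apply: cvgZr; exact: lim_eval_cvg.
exact: lim_eval_cvg.
Qed.

HB.instance Definition _ :=
  GRing.isLinear.Build R[i] CB C *:%R (lim_eval VU) lim_eval_linear.

Lemma lim_eval_continuous : continuous (lim_eval VU).
Proof.
apply: bounded_linear_continuous; apply/linear_boundedP.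
exists 1; split=> // r r1 f; apply: le_trans (_ : `|f| <= _); last first.
  by rewrite ler_peMl// ltW.
rewrite cmodE -[`|f|]/(bcont_norm f) bcont_normE lecR.
have := cvgC_le (c := 0) (lim_eval_cvg f) (e := complex.Re (bcont_norm f)).
rewrite subr0; apply; apply: filterE => j.
by rewrite subr0; exact: bcont_norm_ub.
Qed.

Definition dual_lim : dual CB := exist _ _ lim_eval_continuous.

End LimitFunctional.

Arguments lim_eval_cvg {J V x} VU f.

(** Evaluation at [y] is the limit of a constant family along the one-point ultrafilter, and so
    inherits linearity and continuity from [dual_lim]. *)
Definition dual_eval (y : G) : dual CB :=
  dual_lim (fun=> y) (principal_filter_ultra tt).

Lemma dual_evalE y f : sval (dual_eval y) f = f y.
Proof.
have PF : ProperFilter (principal_filter tt) by exact: principal_filter_proper.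
apply: (cvgC_unique (lim_eval_cvg _ f)).
exact: cvg_cst.
Qed.

Lemma WAP_weak_cvg f : WAP f -> forall (I : Type) (U : set_system I)
    (a : I -> G), UltraFilter U ->
  exists g, forall phi : dual CB,
    sval phi (left_translate (a i) f) @[i --> U] --> (sval phi g : C).
Proof.
move=> [K sK [+ _]] I U a UU; rewrite compact_ultra => cK.
have := cK (fmap (fun i => left_translate (a i) f) U) (fmap_ultra _ UU).
case=> [|g [_ Ug]].
  by rewrite fmapE; apply: filterE => i; apply: sK; exists (a i).
by exists g => phi; have /weak_cvgP := Ug; apply.
Qed.

(** The weak limits of translates along all ultrafilters form the required compact set: an
    ultrafilter of such limits converges to the limit along a combined ultrafilter on [G]. *)
Lemma weak_cvg_WAP f :
  (forall U : set_system G, UltraFilter U -> exists g, forall phi : dual CB,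
    sval phi (left_translate s f) @[s --> U] --> (sval phi g : C)) -> WAP f.
Proof.
move=> H; pose o s := left_translate s f.
pose K : set CB := [set g | exists2 U, UltraFilter U & forall phi : dual CB,
    sval phi (o s) @[s --> U] --> (sval phi g : C)].
have cmpK : compact (K : set (weak CB)).
  rewrite compact_ultra => W UW WK.
  (* The principal filter is a default that keeps [u g] an ultrafilter when [g] lies outside [K]. *)
  pose u (g : CB) : set_system G := xget (principal_filter 1%g)
    [set U | UltraFilter U /\ forall phi : dual CB,
      sval phi (o s) @[s --> U] --> (sval phi g : C)].
  have uU g : UltraFilter (u g).
    by rewrite /u; case: xgetP => [_ _ []//|_]; exact: principal_filter_ultra.
  have uK g : K g -> forall phi : dual CB,
      sval phi (o s) @[s --> u g] --> (sval phi g : C).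
    move=> [U UU Ug]; rewrite /u; case: xgetP => [_ _ []//|/(_ U)[]].
    by split.
  (* The sum of the ultrafilters [u g] over [W]: a limit along it is an iterated limit, first along
     [u g], then along [W]. *)
  pose U : set_system G := [set A | W [set g | u g A]].
  have UU : UltraFilter U.
    split.
      apply: Build_ProperFilter_ex.
        by move=> A WA; have [g uA] := @filter_ex _ W _ _ WA; exact: filter_ex uA.
      split; rewrite /U/=.
      - by apply: filterE => g; exact: filterT.
      - move=> A B WA WB; have WAB : W ([set g | u g A] `&` [set g | u g B]).
          exact: filterI.
        by apply: filterS WAB => g [uA uB]; exact: filterI.
      - by move=> A B AB WA; apply: filterS (WA : W _) => g; exact: filterS.
    move=> H' PH' sub; rewrite predeqE => A; split; last exact: sub.
    move=> HA; apply: contrapT => /(ultra_notP UW) nA.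
    have /sub HnA : U (~` A) by apply: filterS nA => g; exact: ultra_notP.
    have H0 : H' (A `&` ~` A) by exact: filterI.
    by have [? []] := filter_ex H0.
  have [g0 Ug0] := H U UU.
  exists g0; split; first by exists U.
  apply/weak_cvgP => phi; apply/cvgC_cmodP => e e0.
  have e2 : 0 < e / 2 by lra.
  have /cvgC_cmodP/(_ _ e2) Hg0 := Ug0 phi.
  apply: filterS2 WK Hg0 => g Kg ug.
  apply: le_lt_trans (_ : e / 2 < e); last by lra.
  by apply: (cvgC_le (uK _ Kg phi)); apply: filterS ug => s /ltW.
exists (K : set (weak CB)) => [_ [s _ <-]|].
  exists (principal_filter s); first exact: principal_filter_ultra.
  by move=> phi; apply/cvgC_cmodP => e e0 _ ->; rewrite subrr cmod0.
(* Point evaluations separate functions, so the weak topology is Hausdorff and the compact set [K]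
   is closed. *)
split=> //; apply: compact_closed cmpK => g h gh.
apply/val_inj/funext => y; rewrite -[LHS]dual_evalE -[RHS]dual_evalE.
apply: (@norm_hausdorff _ C) => A B nA nB.
have cw (k : weak CB) : sval (dual_eval y) @ k --> (sval (dual_eval y) k : C).
  by apply: (iffLR (@weak_cvgP _ _ (nbhs k) k _)).
have [k [Ak Bk]] := gh _ _ (cw g _ nA) (cw h _ nB).
by exists (sval (dual_eval y) k).
Qed.

(** Double limit condition: both iterated limits along one free ultrafilter equal the value of
    [dual_lim x UU] at the weak limit [g]. This value is within [3^-1] of both [c] and [c'], and two
    thirds is less than 1. *)
Lemma WAP_no_step f : WAP f -> forall (a x : nat -> G) (c c' : C),
  (forall m n, (m < n)%N -> cmod (f (a m * x n)%g - c) <= 3^-1) ->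
  (forall m n, (n < m)%N -> cmod (f (a m * x n)%g - c') <= 3^-1) ->
  cmod (c - c') < 1.
Proof.
move=> Wf a x c c' Hlt Hgt; have [U UU sU] := exists_free_ultra.
have [g Ug] := WAP_weak_cvg Wf a UU.
have Ugt n : U [set m | (n < m)%N] by apply: sU; exists n.+1.
have gc : cmod (sval (dual_lim x UU) g - c) <= 3^-1.
  apply: (cvgC_le (Ug _)); apply: filterE => m.
  apply: (cvgC_le (lim_eval_cvg _ _)).
  by apply: filterS (Ugt m) => n; exact: Hlt.
have gc' : cmod (sval (dual_lim x UU) g - c') <= 3^-1.
  apply: (cvgC_le (lim_eval_cvg _ _)); apply: filterE => n.
  rewrite -dual_evalE; apply: (cvgC_le (Ug _)).
  by apply: filterS (Ugt n) => m; rewrite dual_evalE; exact: Hgt.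
apply: le_lt_trans (cmod_tri (sval (dual_lim x UU) g) _ _) _.
by rewrite (cmodB c); lra.
Qed.

(** Along an ultrafilter of bad [w] tending to the identity, the translates converge weakly, and by
    continuity the limit is [f] itself, where [dual_lim s] vanishes; yet on every bad translate this
    functional has modulus at least [3^-1]. *)
Lemma WAP_equicontinuous_limit f : WAP f ->
  forall (V : set_system nat) (s : nat -> G), UltraFilter V ->
  (forall n, f (s n) = 0) ->
  \forall w \near (1%g : G), \forall n \near V, cmod (f (w * s n)%g) < 3^-1.
Proof.
move=> Wf V s UV fs0; apply: contrapT => nH.
pose B : set G := [set w | \forall n \near V, cmod (f (w * s n)%g) < 3^-1].
have PF : ProperFilter (within (~` B) (nbhs (1%g : G))).
  apply: Build_ProperFilter_ex => A.
  move=> HA; apply: contrapT => nA; apply: nH.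
  apply: filterS (HA : nbhs (1%g : G) [set w | (~` B) w -> A w]) => w HAw.
  by apply: contrapT => nB; apply: nA; exists w; exact: HAw.
have [U [UU sU]] := ultraFilterLemma PF.
have [g Ug] := WAP_weak_cvg Wf id UU.
have gf y : g y = f y.
  have := Ug (dual_eval y); rewrite dual_evalE => gy.
  apply: cvgC_unique gy _; apply/cvgC_cmodP => e e0.
  have cy : (f (w * y)%g : C) @[w --> (1%g : G)] --> (f y : C).
    rewrite -[X in f X]mul1g.
    exact: (continuous_comp (@mulg_continuousl _ y _) (@bcont_continuous f _)).
  move/cvgC_cmodP/(_ e e0) : cy => cy.
  have : U [set w | cmod (f (w * y)%g - f y) < e].
    by apply: sU; apply: filterS cy.
  by apply: filterS => w; rewrite dual_evalE.
have g0 : sval (dual_lim s UV) g = 0.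
  apply: (cvgC_unique (lim_eval_cvg _ _)); apply/cvgC_cmodP => e e0.
  by apply: filterE => n; rewrite gf fs0 subrr cmod0.
suff : 3^-1 <= cmod (sval (dual_lim s UV) g - 0).
  by rewrite g0 subrr cmod0; lra.
apply: (cvgC_ge (Ug _)).
have UnB : U (~` B) by apply: sU; apply: (@filterE _ (nbhs (1%g : G))).
apply: filterS UnB => w /(ultra_notP UV) nBw.
apply: (cvgC_ge (lim_eval_cvg _ _)); apply: filterS nBw => n.
by move=> /negP; rewrite -leNgt subr0.
Qed.

End WeakLimits.

(** * Double limits and necessity *)

Section Metrizable.
Context (R : realType) (T : topologicalType) (d : T -> T -> R).
Hypotheses (d0 : forall x y, d x y = 0 <-> x = y)
  (dC : forall x y, d x y = d y x)
  (dD : forall x y z, d x z <= d x y + d y z)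
  (dP : forall (x : T) (A : set T),
    nbhs x A <-> exists2 r : R, 0 < r & [set y | d x y < r] `<=` A).

Lemma dist_ge0 x y : 0 <= d x y.
Proof. by have := dD x y x; rewrite (iffRL (d0 x x) erefl) (dC y x); lra. Qed.

Lemma dist_ball_nbhs x r : 0 < r -> nbhs x [set y | d x y < r].
Proof. by move=> r0; apply/dP; exists r. Qed.

Lemma dist_hausdorff : hausdorff_space T.
Proof.
move=> p q pq; apply/d0; apply/eqP; rewrite eq_le dist_ge0 andbT leNgt.
apply/negP => pq0; have r0 : 0 < d p q / 2 by lra.
have [z [/= pz qz]] := pq _ _ (dist_ball_nbhs p r0) (dist_ball_nbhs q r0).
by have := dD p z q; rewrite (dC z q); lra.
Qed.

Lemma dist_continuous x : continuous (d x : T -> R^o).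
Proof.
move=> y; apply/cvgrPdist_lt => e e0.
apply: filterS (dist_ball_nbhs y e0) => z /= yz.
rewrite ltr_norml; have := dD x y z; have := dD x z y; rewrite (dC z y).
by move=> *; apply/andP; split; lra.
Qed.

End Metrizable.

Section Precompact.
Context (X : topologicalType).

Lemma precompactP (A : set X) : hausdorff_space X ->
  precompact A <-> exists2 K, compact K & A `<=` K.
Proof.
move=> hX; split=> [[K AK [cK _]]|[K cK AK]]; first by exists K.
by apply: precompact_subset AK _; exact: compact_precompact.
Qed.

Lemma precompactU (A B : set X) :
  precompact A -> precompact B -> precompact (A `|` B).
Proof. by rewrite !precompactE closureU; exact: compactU. Qed.

Lemma precompact0 : precompact (@set0 X).
Proof. by rewrite precompactE closure0; exact: compact0. Qed.

Lemma precompact_bigU Y (l : seq Y) (F : Y -> set X) :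
  (forall y, precompact (F y)) -> precompact [set z | exists2 y, List.In y l & F y z].
Proof.
move=> pF; elim: l => [|y l IH].
  by apply: precompact_subset precompact0 => z [].
apply: precompact_subset (precompactU (pF y) IH) => z [y' [<-|yl] Fz]; first by left.
by right; exists y'.
Qed.

Lemma nonprecompact_avoid (L A : set X) :
  ~ precompact L -> precompact A -> exists2 s, L s & ~ A s.
Proof.
move=> nL pA; apply: contrapT => H; apply: nL; apply: precompact_subset pA => s Ls.
by apply: contrapT => As; apply: H; exists s.
Qed.

End Precompact.

Lemma finite_In (X : Type) (l : seq X) : finite_set [set z | List.In z l].
Proof.
elim: l => [|y l IH]; first exact: finite_set0.
rewrite (_ : [set z | _] = [set y] `|` [set z | List.In z l]) ?finite_setU//.
by rewrite predeqE => z; split=> -[|]; [left|right|left|right].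
Qed.

(* [E q p] stands for [q] in [N N^-1 p], and [beta] for the product of its two
   arguments in either order, so that left and right are treated at once. *)
Lemma escaping_sequences (X : topologicalType) (beta : X -> X -> X)
    (E : X -> X -> Prop) (S L : set X) :
  (forall x p, precompact [set s | E (beta s x) p]) ->
  (forall s q, precompact [set x | E q (beta s x)]) ->
  ~ precompact L ->
  (forall F, finite_set F -> F `<=` L ->
    ~ precompact [set x | forall b, F b -> S (beta b x)]) ->
  exists s x : nat -> X,
    (forall i j, (i < j)%N -> S (beta (s i) (x j))) /\
    (forall i j k l, (j < i)%N -> (k < l)%N ->
      ~ E (beta (s i) (x j)) (beta (s k) (x l))).
Proof.
move=> Es Ex nL nF.
pose good (h : seq (X * X)) := forall a, List.In a h -> L a.1.
pose P (h : seq (X * X)) (y : X * X) := [/\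
  forall a, List.In a h -> S (beta a.1 y.2),
  forall a b c, List.In a h -> List.In b h -> List.In c h ->
    ~ E (beta y.1 c.2) (beta a.1 b.2) &
  forall a b c, List.In a h -> List.In b (y :: h) -> List.In c h ->
    ~ E (beta b.1 c.2) (beta a.1 y.2)].
have [//|h gh|y yP] := @dependent_choice_history _ good P.
  (* The new [s] is chosen first and avoids finitely many precompact sets; [x] is chosen second, so
     its conditions may involve [s]. *)
  have [s Ls sP] := nonprecompact_avoid nL (precompact_bigU h (fun a =>
    precompact_bigU h (fun b => precompact_bigU h (fun c =>
      Es c.2 (beta a.1 b.2))))).
  pose F : set X := [set a.1 | a in [set a | List.In a h]].
  have finF : finite_set F by apply: finite_image; exact: finite_In.
  have FL : F `<=` L by move=> _ [a ha <-]; exact: gh.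
  have [x Dx xP] := nonprecompact_avoid (nF F finF FL) (precompact_bigU h (fun a =>
    precompact_bigU (s :: map fst h) (fun b => precompact_bigU h (fun c =>
      Ex a.1 (beta b c.2))))).
  exists (s, x); split; first by move=> a [<-|/gh].
  split=> [a ha|a b c ha hb hc /= Eab|a b c ha hb hc /= Eab].
  - by apply: Dx; exists a.
  - by apply: sP; exists a => //; exists b => //; exists c.
  - apply: xP; exists a => //; exists b.1; last by exists c.
    by case: hb => [<-|hb]; [left|right; exact: List.in_map].
exists (fst \o y), (snd \o y); split=> [i j ij|i j k l ji kl].
  by have [_ [+ _ _]] := yP j; apply; exact: in_history.
(* The element chosen last takes the blame: [s i] if [l < i], and otherwise [x l], where [i = l] is
   allowed because [s l] precedes [x l]. *)
have [li|il] := ltnP l i.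
  have [_ [_ + _]] := yP i; apply; apply: in_history => //.
  exact: ltn_trans kl li.
have [_ [_ _]] := yP l; apply; [exact: in_history| |].
  move: il; rewrite leq_eqVlt => /orP[/eqP->|il]; first by left.
  by right; exact: in_history.
by apply: in_history; exact: leq_trans ji il.
Qed.

Section Necessity.
Context (R : realType) (G : topologicalGroupType).
Hypothesis hG : hausdorff_space G.
Local Notation C := (R[i]^o).
Local Notation CB := (bcontType R G).

Lemma precompact_double_translate (N : set G) (u w : G) : compact N ->
  precompact [set z | exists v2 v1, [/\ N v2, N v1 & z = (u * (v2 * v1^-1) * w)%g]].
Proof.
move=> cN; apply/(precompactP _ hG).
exists ((fun v : G * G => (u * (v.1 * v.2^-1) * w)%g) @` (N `*` N)); last first.
  by move=> _ [v2 [v1 [N2 N1 ->]]]; exists (v2, v1).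
apply: continuous_compact; last exact: compact_setX.
apply: continuous_subspaceT => v.
apply: (@continuous_comp _ _ _ (fun v : G * G => u * (v.1 * v.2^-1))%g (fun z => z * w)%g);
  last exact: mulg_continuousl.
apply: (@continuous_comp _ _ _ (fun v : G * G => v.1 * v.2^-1)%g (fun z => u * z)%g);
  last exact: mulg_continuousr.
apply: (@continuous_comp _ _ _ (fun v : G * G => (v.1, v.2^-1)%g) (fun z => z.1 * z.2)%g);
  last exact: mulg_continuous.
apply: cvg_pair => /=; first exact: cvg_fst.
apply: (@continuous_comp _ _ _ (@snd G G) (fun z => z^-1)%g); last exact: invg_continuous.
exact: cvg_snd.
Qed.

(** Failure on either side feeds [escaping_sequences], and the function attached to a suitable part
    of [T] is then 1 above the diagonal and 0 below it, which [WAP_no_step] excludes. *)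
Lemma approximable_translation_compact (T N V1 V2 : set G) : compact N ->
  V1 `<=` V2 -> V2 `<=` N ->
  (forall T1 : set G, T1 `<=` T -> exists h : CB, [/\ WAP h,
     h @` mulset V1 T1 `<=` [set 1] & h @` (~` mulset V2 T1) `<=` [set 0]]) ->
  translation_compact (mulset V1 T).
Proof.
move=> cN V12 V2N H.
pose E q p := exists v2 v1, [/\ N v2, N v1 & q = ((v2 * v1^-1) * p)%g].
have step (z : nat -> nat -> G) :
  (forall i j, (i < j)%N -> mulset V1 T (z i j)) ->
  (forall i j k l, (j < i)%N -> (k < l)%N -> ~ E (z i j) (z k l)) ->
  exists h : CB, [/\ WAP h, forall i j, (i < j)%N -> h (z i j) = 1 &
    forall i j, (j < i)%N -> h (z i j) = 0].
  move=> zV zE.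
  pose T1 := [set t | T t /\ exists i j v, [/\ (i < j)%N, V1 v & z i j = (v * t)%g]].
  have [|h [Wh h1 h0]] := H T1; first by move=> t [].
  exists h; split=> // i j ij.
    have [v V1v [t Tt vt]] := zV i j ij.
    apply: h1; exists (z i j) => //; exists v => //; exists t => //.
    by split=> //; exists i, j, v.
  (* A common [t] for an entry below and an entry above the diagonal would put the former in
     [N N^-1] times the latter. *)
  apply: h0; exists (z i j) => // -[v V2v [t [Tt [k [l [w [kl V1w zkl]]]]] vt]].
  apply: (zE i j k l) => //; exists v, w; split; [exact: V2N|by apply/V2N/V12|].
  by rewrite zkl -vt mulgA mulgVK.
have one_step : cmod (1 - 0 : R[i]) < 1 -> False.
  by rewrite subr0 cmod1 ltxx.
split=> L nL; apply: contrapT => nF.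
- have [x p|s q||F finF FL pF|s [x [sx1 sx0]]] := @escaping_sequences G
      (fun s x => s * x)%g E (mulset V1 T) L.
  + apply: precompact_subset (precompact_double_translate 1%g (p * x^-1)%g cN).
    move=> s [v2 [v1 [N2 N1 e]]]; exists v2, v1; split=> //.
    by rewrite mul1g mulgA -e mulgK.
  + apply: precompact_subset (precompact_double_translate s^-1%g q cN).
    move=> x [v2 [v1 [N2 N1 e]]]; exists v1, v2; split=> //.
    by rewrite e !mulgA mulgVK mulgK mulVg mul1g.
  + by [].
  + apply: nF; exists F; split=> //; apply: precompact_subset pF => x Fx b Fb.
    have [_ -> [y Sy <-]] := Fx b Fb.
    by rewrite mulVKg.
  have [h [Wh h1 h0]] := step (fun i j => s i * x j)%g sx1 sx0.
  apply: one_step; apply: (WAP_no_step Wh (a := s) (x := x)) => m n mn.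
    by rewrite h1// subrr cmod0 invr_ge0.
  by rewrite h0// subrr cmod0 invr_ge0.
- have [x p|s q||F finF FL pF|s [x [sx1 sx0]]] := @escaping_sequences G
      (fun s x => x * s)%g E (mulset V1 T) L.
  + apply: precompact_subset (precompact_double_translate x^-1%g p cN).
    move=> s [v2 [v1 [N2 N1 e]]]; exists v2, v1; split=> //.
    by rewrite -mulgA -e mulKg.
  + apply: precompact_subset (precompact_double_translate 1%g (q * s^-1)%g cN).
    move=> x [v2 [v1 [N2 N1 e]]]; exists v1, v2; split=> //.
    by rewrite e mul1g !mulgA mulgVK mulgV mul1g mulgK.
  + by [].
  + apply: nF; exists F; split=> //; apply: precompact_subset pF => x Fx b Fb.
    have [y Sy [_ -> <-]] := Fx b Fb.
    by rewrite mulgVK.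
  have [h [Wh h1 h0]] := step (fun i j => x j * s i)%g sx1 sx0.
  (* In this order [x] supplies the left factors, so the values 0 and 1 trade places. *)
  apply: one_step; rewrite -cmodB.
  apply: (WAP_no_step Wh (a := x) (x := s)) => m n mn.
    by rewrite h0// subrr cmod0 invr_ge0.
  by rewrite h1// subrr cmod0 invr_ge0.
Qed.

(** * Interpolation forces right uniform discreteness *)

Definition WAP_interpolation (T : set G) := forall c : G -> C, forall M : R,
  (forall x, cmod (c x) <= M) ->
  exists2 g : CB, WAP g & forall t, T t -> g t = c t.

(** A continuous extension of the indicator of [s] cannot drop from 1 to 0 at points of [T]
    arbitrarily close to [s]. *)
Lemma interpolation_discrete (T : set G) : WAP_interpolation T ->
  forall s, T s -> \forall v \near (1%g : G), v <> 1%g -> ~ T (v * s)%g.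
Proof.
move=> iT s Ts.
have [x|g Wg gE] := iT (fun x => if `[<x = s>] then 1 else 0) 1.
  by case: asboolP => _; rewrite ?cmod0// cmod1.
have cg : (g (v * s)%g : C) @[v --> (1%g : G)] --> (g s : C).
  rewrite -[s in g s]mul1g.
  exact: (continuous_comp (@mulg_continuousl _ s _) (@bcont_continuous _ _ g _)).
have /cvgC_cmodP/(_ 1 ltr01) := cg; apply: filterS => v + v1 Tvs.
rewrite !gE//; case: asboolP => [vs|_].
  by case: v1; apply: (mulIg s); rewrite vs mul1g.
case: asboolP => // _.
by rewrite sub0r cmodN cmod1 ltxx.
Qed.

Lemma nbhs1_div (O : set G) : nbhs (1%g : G) O ->
  exists2 V, nbhs (1%g : G) V & forall a b, V a -> V b -> O (b^-1 * a)%g.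
Proof.
move=> nO.
have : \forall z \near ((1%g : G), (1%g : G)), O (z.2^-1 * z.1)%g.
  have cz : continuous (fun z : G * G => (z.2^-1 * z.1)%g).
    move=> z; apply: (@continuous_comp _ _ _ (fun v : G * G => (v.2^-1, v.1)%g) (fun z => z.1 * z.2)%g);
      last exact: mulg_continuous.
    apply: cvg_pair => /=; last exact: cvg_fst.
    apply: (@continuous_comp _ _ _ (@snd G G) (fun z => z^-1)%g); last exact: invg_continuous.
    exact: cvg_snd.
  by apply: (cz (1%g, 1%g)); rewrite /= mulg1 invg1.
move=> [[A B] [/= nA nB] AB]; exists (A `&` B); first exact: filterI.
by move=> a b [Aa _] [_ Bb]; exact: (AB (a, b)).
Qed.

Section Metric.
Context (d : G -> G -> R).
Hypothesis dP : forall (x : G) (A : set G),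
    nbhs x A <-> exists2 r : R, 0 < r & [set y | d x y < r] `<=` A.

(** The last clause keeps the points [s m] apart from the points [v n * s n], so that one function
    can be prescribed as 0 on the former and 1 on the latter. *)
Lemma not_discrete_pairs (T : set G) : WAP_interpolation T ->
  (forall V, nbhs (1%g : G) V -> ~ right_uniformly_discrete V T) ->
  exists s v : nat -> G, [/\ v @ \oo --> (1%g : G),
    forall n, T (s n) /\ T (v n * s n)%g &
    forall m n, s m <> (v n * s n)%g].
Proof.
move=> iT nT.
have pairs O : nbhs (1%g : G) O -> exists s v,
    [/\ T s, T (v * s)%g, O v & v <> 1%g].
  move=> /nbhs1_div[V nV VO]; apply: contrapT => H; apply: (nT V nV) => s s' Ts Ts' ss'.
  rewrite predeqE => z; split=> // -[[a Va [_ -> az]] [b Vb [_ -> bz]]].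
  have s'E : s' = (b^-1 * a * s)%g by rewrite -mulgA az -bz mulKg.
  apply: H; exists s, (b^-1 * a)%g; rewrite -s'E; split=> //; first exact: VO.
  by move=> e; apply: ss'; rewrite s'E e mul1g.
pose good (l : seq (G * G)) := forall a, List.In a l -> T a.1 /\ T (a.2 * a.1)%g.
pose P (l : seq (G * G)) (y : G * G) := [/\ d 1%g y.2 < (size l).+1%:R^-1,
  T y.1 /\ T (y.2 * y.1)%g, y.2 <> 1%g & forall a, List.In a l ->
    y.1 <> (a.2 * a.1)%g /\ a.1 <> (y.2 * y.1)%g].
have [//|l gl|y yP] := @dependent_choice_history _ good P.
  (* A coincidence with an older pair [a] would put into [T] the translate of a point of [T] by [v]
     or its inverse; discreteness at that point forbids this for [v] near the identity. *)
  pose A (a : G * G) v := v <> 1%g -> ~ T (v * (a.2 * a.1))%g /\ ~ T (v^-1 * a.1)%g.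
  have nA : \forall v \near (1%g : G), forall a, List.In a l -> A a v.
    apply: near_In => a al; have [Ta Ta'] := gl a al.
    have nI := interpolation_discrete iT Ta.
    have : \forall v \near (1%g : G), v^-1%g <> 1%g -> ~ T (v^-1 * a.1)%g.
      have := @invg_continuous G 1%g; rewrite /continuous_at invg1.
      by move=> /(_ _ nI).
    apply: filterS2 (interpolation_discrete iT Ta') => v H1 H2 v1.
    split; first exact: H1.
    by apply: H2 => /(congr1 (fun x => x^-1)%g); rewrite invgK invg1.
  have nd : \forall v \near (1%g : G), d 1%g v < (size l).+1%:R^-1.
    by apply/dP; exists (size l).+1%:R^-1 => //; rewrite invr_gt0 ltr0n.
  have [s [v [Ts Tvs [Av dv] v1]]] := pairs _ (filterI nA nd).
  exists (s, v); split; first by move=> a [<-|/gl].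
  split=> // a al; have [H1 H2] := Av a al v1; split=> /= e.
    by apply: H1; rewrite -e.
  by apply: H2; rewrite e mulKg.
exists (fst \o y), (snd \o y); split.
- move=> A /dP[r r0 rA]; exists (Num.truncn r^-1) => // n /= rn; apply: rA => /=.
  have [_ [+ _ _ _]] := yP n; rewrite size_rev size_mkseq => /lt_le_trans; apply.
  rewrite invf_ple ?posrE ?ltr0n//; apply/ltW/(lt_le_trans (truncnS_gt _)).
  by rewrite ler_nat.
- by move=> n; have [_ []] := yP n.
- move=> m n e; have [mn|nm|mn] := ltngtP m n.
  + have [_ [_ _ _ /(_ _ (in_history y mn))[_]]] := yP n.
    by apply.
  + have [_ [_ _ _ /(_ _ (in_history y nm))[+ _]]] := yP m.
    by apply.
  + have [_ [_ _ + _]] := yP n; apply.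
    by apply: (mulIg (y n).1); rewrite mul1g -e mn.
Qed.

Lemma interpolation_right_uniformly_discrete (T : set G) : WAP_interpolation T ->
  exists2 V, nbhs (1%g : G) V & right_uniformly_discrete V T.
Proof.
move=> iT; apply: contrapT => nT.
have [|s [v [v1 Tsv sv]]] := not_discrete_pairs iT.
  by move=> V nV VT; apply: nT; exists V.
pose c x : C := if `[<exists n, x = (v n * s n)%g>] then 1 else 0.
have [x|g Wg gE] := iT c 1.
  by rewrite /c; case: asboolP => _; rewrite ?cmod0// cmod1.
have gs n : g (s n) = 0.
  rewrite gE; last exact: (Tsv n).1.
  by rewrite /c; case: asboolP => // -[m] /sv.
have gvs n : g (v n * s n)%g = 1.
  rewrite gE; last exact: (Tsv n).2.
  by rewrite /c; case: asboolP => // -[]; exists n.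
have [V UV sV] := exists_free_ultra.
pose O : set G := [set w | \forall n \near V, cmod (g (w * s n)%g) < 3^-1].
have nO : nbhs (1%g : G) O := WAP_equicontinuous_limit Wg UV gs.
have Vv A : nbhs (1%g : G) A -> \forall n \near V, A (v n).
  by move=> nA; apply: sV; exact: (v1 _ nA).
(* Here [u] is the running product of the chosen [v k]. Both conditions are open in [u], hence
   survive its replacement by [v k * u] with [v k] close to the identity. *)
pose A (z : G * G) u := nbhs (z.1 * u^-1)%g O /\ cmod (g (u * z.2)%g - 1) < 3^-1.
pose good (l : seq (G * G)) := exists u, forall z, List.In z l -> A z u.
pose P (l : seq (G * G)) (y : G * G) := forall z, List.In z l ->
  cmod (g (z.1 * y.2)%g) < 3^-1 /\ cmod (g (y.1 * z.2)%g - 1) < 3^-1.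
have [|l [u Au]|y yP] := @dependent_choice_history _ good P.
- by exists 1%g => z [].
- have H1 : \forall k \near V, forall z, List.In z l ->
      cmod (g (z.1 * (u^-1 * s k))%g) < 3^-1.
    apply: near_In => z zl; have [/nbhs_singleton Oz _] := Au z zl.
    by apply: filterS Oz => k; rewrite mulgA.
  have H2 : \forall k \near V, forall z, List.In z l -> A z (v k * u)%g.
    apply: near_In => z zl; have [nOz gz] := Au z zl.
    apply: (Vv (fun w => A z (w * u)%g)); apply: filterI.
      have cw : {for (1%g : G), continuous (fun w => (z.1 * (w * u)^-1)%g)}.
        apply: (@continuous_comp _ _ _ (fun w : G => (w * u)^-1)%g (fun w => z.1 * w)%g);
          last exact: mulg_continuousr.
        apply: (@continuous_comp _ _ _ (fun w : G => (w * u))%g (fun w => w^-1)%g);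
          last exact: invg_continuous.
        exact: mulg_continuousl.
      by apply: (cw O^°); rewrite mul1g; exact: nbhs_interior.
    have cg : (g (w * (u * z.2))%g : C) @[w --> (1%g : G)] --> (g (u * z.2)%g : C).
      rewrite -[X in g X]mul1g.
      exact: (continuous_comp (@mulg_continuousl _ _ _) (@bcont_continuous _ _ g _)).
    have e0 : 0 < 3^-1 - cmod (g (u * z.2)%g - 1) by rewrite subr_gt0.
    have /cvgC_cmodP/(_ _ e0) := cg; apply: filterS => w Hw.
    rewrite /= -mulgA; apply: le_lt_trans (cmod_tri (g (u * z.2)%g) _ _) _.
    by rewrite -ltrBrDr.
  have [k [H1k H2k]] := filter_ex (filterI H1 H2).
  (* Multiplying the new second entry by the new product gives [v k * s k], where [g] is 1;
     multiplying it by an older first entry [z.1] gives [z.1 * u^-1 * s k], with [z.1 * u^-1] in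
     [O], where [g] is small. *)
  exists (v k * u, u^-1 * s k)%g; split.
    exists (v k * u)%g => z [<-|/H2k//]; split=> /=; first by rewrite mulgV.
    by rewrite mulgA mulgK gvs subrr cmod0 invr_gt0.
  by move=> z zl; split; [exact: H1k|have [_] := H2k z zl].
suff : cmod (0 - 1 : R[i]) < 1 by rewrite sub0r cmodN cmod1 ltxx.
apply: (WAP_no_step Wg (a := fst \o y) (x := snd \o y)) => [m n mn|m n nm].
  have [_ /(_ _ (in_history y mn))[+ _]] := yP n.
  by rewrite subr0 => /ltW.
by have [_ /(_ _ (in_history y nm))[_ /ltW]] := yP m.
Qed.

End Metric.

End Necessity.

(** * A combinatorial argument in the style of Ptak's lemma *)

Section PtakStep.
Context (R : realType) (A : comPzRingType) (mult Cut : set A) (mu : A -> R) (B : R).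
Context (I : Type) (U : set_system I) (u : I -> A) (UU : UltraFilter U).
Hypotheses (multM : forall f g, mult f -> mult g -> mult (f * g))
  (multC : forall f, mult f -> mult (1 - f))
  (mu_ge0 : forall f, mult f -> 0 <= mu f)
  (mu_le : forall f, mult f -> mu f <= B)
  (mu_split : forall f g, mult f -> mult g -> mu f = mu (f * g) + mu (f * (1 - g)))
  (multu : forall i, mult (u i))
  (Cut_mult : forall p, Cut p -> mult p)
  (Cut1 : Cut 1)
  (CutM : forall p q, Cut p -> Cut q -> Cut (p * q)).

(** In the application, [mult] consists of the continuous functions into [0,1], [Cut] of those equal
    to 1 off a precompact set, and [mu] is the variation of a functional; [nu] measures the mass
    that [h] shares with a generic [u i]. *)
Definition nu (h : A) : R := lim ((mu (h * u i) : R^o) @[i --> U]).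

Lemma nu_cvg h : mult h -> (mu (h * u i) : R^o) @[i --> U] --> (nu h : R^o).
Proof.
move=> mh; apply: (@ultra_bounded_cvg _ _ _ (fun i => mu (h * u i)) B UU) => i.
by rewrite ger0_norm ?mu_le ?mu_ge0//; exact: multM.
Qed.

Lemma nu_split f g : mult f -> mult g -> nu f = nu (f * g) + nu (f * (1 - g)).
Proof.
move=> mf mg; apply: (cvg_unique _ (nu_cvg mf)); first exact: norm_hausdorff.
rewrite (_ : (fun i => _) = (fun i => mu (f * g * u i) + mu (f * (1 - g) * u i))).
  by apply: cvgD; apply: nu_cvg; apply: multM => //; exact: multC.
apply/funext => i; rewrite (mu_split (multM mf (multu i)) mg).
by rewrite (mulrAC f (u i) g) (mulrAC f (u i) (1 - g)).
Qed.

Lemma le_nu c h : mult h -> (\forall i \near U, c <= mu (h * u i)) -> c <= nu h.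
Proof. by move=> mh; apply: limr_ge; apply/cvg_ex; exists (nu h); exact: nu_cvg. Qed.

Lemma nu_ge0 h : mult h -> 0 <= nu h.
Proof. by move=> mh; apply: le_nu => //; apply: filterE => i; apply/mu_ge0/multM. Qed.

Lemma mu_mul_le f g : mult f -> mult g -> mu (f * g) <= mu f.
Proof. by move=> mf mg; rewrite (mu_split mf mg) lerDl; apply/mu_ge0/multM/multC. Qed.

Lemma nu_mul_le f g : mult f -> mult g -> nu (f * g) <= nu f.
Proof. by move=> mf mg; rewrite (nu_split mf mg) lerDl; apply/nu_ge0/multM/multC. Qed.

Lemma nu_lt c h (D : set I) : mult h -> U D -> c < nu h ->
  exists2 i, D i & c < mu (h * u i).
Proof.
move=> mh UD ch; have e0 : 0 < nu h - c by lra.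
have /cvgrPdist_lt/(_ _ e0) H := nu_cvg mh.
have [i [Di]] := filter_ex (filterI UD H).
by rewrite /= ltr_norml => /andP[_ H2]; exists i => //; lra.
Qed.

(** The shared mass sits at infinity: no cutoff makes it arbitrarily small. *)
Definition heavy (h : A) := mult h /\
  exists2 c, 0 < c & forall p, Cut p -> c <= nu (h * p).

(* Otherwise, removing from [h] one overlap [u s] at a time (up to a negligible
   part) keeps [nu] above [c / 2] while [mu] decreases by [c / 2] each time. *)
Lemma heavy_step h (D : set I) : heavy h -> U D ->
  exists2 s, D s & heavy (h * u s).
Proof.
move=> [mh [c c0 hc]] UD; apply: contrapT => nH.
have light s e : D s -> 0 < e -> exists2 p, Cut p & nu (h * u s * p) < e.
  move=> Ds e0; apply: contrapT => H; apply: nH; exists s => //.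
  split; first exact: multM.
  exists e => // p Cp; rewrite leNgt; apply/negP => ?; apply: H; by exists p.
pose Rem := [set r : A | mult r /\ (exists2 m, mult m & r = h * m) /\
  exists2 e, 0 < e & forall p, Cut p -> c / 2 + e <= nu (r * p)].
have mult1 : mult 1 by apply: Cut_mult.
have Rh : Rem h.
  split=> //; split; first by exists 1 => //; rewrite mulr1.
  by exists (c / 2) => [|p Cp]; [lra|rewrite -splitr; exact: hc].
have infR : has_inf (mu @` Rem).
  split; first by exists (mu h), h.
  by exists 0 => _ [r [mr _] <-]; exact: mu_ge0.
have c2 : 0 < c / 2 by lra.
(* Taking a remainder within [c / 2] of the infimum of [mu] replaces the iteration: one more removal
   falls below the infimum. *)
have [_ [r [mr [[m mm rE] [e e0 re]]] <-] mur] := inf_adherent c2 infR.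
have nur : c / 2 < nu r by have := re 1 Cut1; rewrite mulr1; lra.
have [s Ds mus] := nu_lt mr UD nur.
have e2 : 0 < e / 2 by lra.
have [p Cp nup] := light s _ Ds e2.
have mp := Cut_mult Cp.
have mr' : mult (r * (1 - u s) * p) by apply: multM => //; apply/multM/multC.
have : Rem (r * (1 - u s) * p).
  split=> //; split.
    exists (m * (1 - u s) * p); first by apply: multM => //; apply/multM/multC.
    by rewrite rE !mulrA.
  (* The overlap removed costs less than [e / 2] of [nu], so half of the margin is left. *)
  exists (e / 2) => // q Cq; have mq := Cut_mult Cq.
  have Rpq := re _ (CutM Cp Cq).
  have mrpq : mult (r * (p * q)) by apply/multM => //; exact: multM.
  have := nu_split mrpq (multu s).
  rewrite (_ : r * (p * q) * (1 - u s) = r * (1 - u s) * p * q); last by ring.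
  have : nu (r * (p * q) * u s) <= nu (h * u s * p).
    rewrite (_ : r * (p * q) * u s = (h * u s * p) * (m * q)); last by rewrite rE; ring.
    by apply: nu_mul_le; apply: multM => //; apply: multM.
  lra.
move=> Rr'; have := ge_inf infR.2 (ex_intro2 _ _ _ Rr' erefl).
have := mu_mul_le (multM mr (multC (multu s))) mp.
by have := mu_split mr (multu s); move=> *; lra.
Qed.

End PtakStep.

Lemma finite_set_In (X : choiceType) (F : set X) : finite_set F ->
  exists l : seq X, forall x, F x <-> List.In x l.
Proof.
move=> /finite_seqP[l ->]; exists l => x /=.
elim: l => [|y l IH]; first by rewrite in_nil.
rewrite in_cons /=; split=> [/orP[/eqP->|/IH]|[->|/IH->]]; [by left|by right| |].
  by rewrite eqxx.
by rewrite orbT.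
Qed.

(** * Multipliers, cutoffs and the total variation of a functional *)

Section Multipliers.
Context (R : realType) (G : topologicalGroupType).
Local Notation C := (R[i]^o).
Local Notation CB := (bcontType R G).

Definition multiplier : set (G -> R) :=
  [set f : G -> R | continuous f /\ forall x, 0 <= f x <= 1].

Lemma multiplierM f g : multiplier f -> multiplier g -> multiplier (f * g).
Proof.
move=> [cf f01] [cg g01]; split=> [x|x]; first by apply: cvgM; [exact: cf|exact: cg].
have /andP[? ?] := f01 x; have /andP[? ?] := g01 x.
by rewrite mulr_ge0//= mulr_ile1.
Qed.

Lemma multiplierC f : multiplier f -> multiplier (1 - f).
Proof.
move=> [cf f01]; split=> [x|x]; first by apply: cvgB; [exact: cvg_cst|exact: cf].
rewrite (_ : (1 - f) x = 1 - f x)//.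
by have /andP[? ?] := f01 x; rewrite subr_ge0 lerBlDr lerDl; apply/andP.
Qed.

Lemma multiplier1 : multiplier 1.
Proof.
split=> [x|x]; first exact: (@cst_continuous G R 1 x).
by rewrite -[(1 : G -> R) x]/(1 : R) ler01 lexx.
Qed.

Definition cutoff : set (G -> R) :=
  [set p : G -> R | multiplier p /\ precompact [set x | p x <> 1]].

Lemma cutoff1 : cutoff 1.
Proof.
split; first exact: multiplier1.
by apply: precompact_subset (@precompact0 G) => x.
Qed.

Lemma cutoffM p q : cutoff p -> cutoff q -> cutoff (p * q).
Proof.
move=> [mp cp] [mq cq]; split; first exact: multiplierM.
apply: precompact_subset (precompactU cp cq) => x /= pq.
have [px|px] := pselect (p x = 1); last by left.
by right=> qx; apply: pq; rewrite -[(p * q) x]/(p x * q x) px qx mulr1.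
Qed.

Lemma bcont_mul (f : CB) (m : G -> R) : multiplier m ->
  exists g : CB, forall x, g x = f x * (m x)%:C%C.
Proof.
move=> [cm m01]; have [M M0 fM] := bcont_bounded f.
apply: (@bcont_exists _ _ (fun x => (f x : R[i]) * (m x)%:C%C) M) => x.
  have cmC : ((m y)%:C%C : C) @[y --> x] --> ((m x)%:C%C : C).
    apply/cvgC_cmodP => e e0; have /cvgrPdist_lt/(_ _ e0) := cm x.
    by apply: filterS => y; rewrite -rmorphB cmod_real distrC.
  by apply: (cvgM (@bcont_continuous _ _ f x) cmC).
have /andP[m0 m1] := m01 x.
by rewrite cmodM cmod_real ger0_norm// (le_trans _ (fM x))// ler_piMr// cmod_ge0.
Qed.

Section Variation.
Context (phi : dual CB).

(** The total variation of [phi] evaluated at [h]; since [g] may be rotated by unimodular constants,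
    the real part gives the same supremum as the modulus. *)
Definition variation (h : G -> R) : R :=
  sup [set complex.Re (sval phi g) | g in [set g : CB | forall x, cmod (g x) <= h x]].

Let Re_le : exists B : R, forall h (g : CB), multiplier h ->
  (forall x, cmod (g x) <= h x) -> complex.Re (sval phi g) <= B.
Proof.
have [B _ BP] := dual_bound phi; exists (B * 1) => h g [_ h01] gh.
apply: le_trans (ler_norm _) _; apply: le_trans (Re_le_cmod _) _.
by apply: BP => // x; apply: le_trans (gh x) _; have /andP[] := h01 x.
Qed.

Lemma variation_ub h (g : CB) : multiplier h -> (forall x, cmod (g x) <= h x) ->
  complex.Re (sval phi g) <= variation h.
Proof.
move=> mh gh; apply: ub_le_sup; last by exists g.
by have [B BP] := Re_le; exists B => _ [k kh <-]; exact: BP kh.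
Qed.

Lemma variation_le h (c : R) : multiplier h ->
  (forall g : CB, (forall x, cmod (g x) <= h x) -> complex.Re (sval phi g) <= c) ->
  variation h <= c.
Proof.
move=> [_ h01] H; apply: ge_sup => [|_ [g gh <-]]; last exact: H.
exists (complex.Re (sval phi 0)), 0 => // x.
by rewrite cmod0; have /andP[] := h01 x.
Qed.

Lemma variation_bounded : exists B', forall h, multiplier h -> variation h <= B'.
Proof.
by have [B BP] := Re_le; exists B => h mh; apply: variation_le => // g; exact: BP.
Qed.

Lemma variation_ge0 h : multiplier h -> 0 <= variation h.
Proof.
move=> mh; have /= := @variation_ub h 0 mh.
rewrite linear0 /=; apply=> x; rewrite cmod0.
by have /andP[] := mh.2 x.
Qed.

(* Splitting along a multiplier [g], instead of an arbitrary sum, avoids dividing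
   by functions that vanish. *)
Lemma variation_split f g : multiplier f -> multiplier g ->
  variation f = variation (f * g) + variation (f * (1 - g)).
Proof.
move=> mf mg; have mfg := multiplierM mf mg.
have mfg' := multiplierM mf (multiplierC mg).
apply/eqP; rewrite eq_le; apply/andP; split.
  apply: variation_le => // k kf.
  have [k1 k1E] := bcont_mul k mg.
  have [k2 k2E] := bcont_mul k (multiplierC mg).
  have -> : k = k1 + k2.
    apply/val_inj/funext => x /=; rewrite -[RHS]/(k1 x + k2 x) k1E k2E -mulrDr.
    by rewrite -rmorphD (_ : g x + (1 - g) x = 1) ?mulr1//; rewrite addrC subrK.
  rewrite linearD raddfD lerD//; apply: variation_ub => // x.
    rewrite k1E cmodM cmod_real ger0_norm; last by have /andP[] := mg.2 x.
    by apply: ler_wpM2r => //; have /andP[] := mg.2 x.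
  have m01 := (multiplierC mg).2 x.
  rewrite k2E cmodM cmod_real ger0_norm; last by have /andP[] := m01.
  by apply: ler_wpM2r => //; have /andP[] := m01.
rewrite -lerBrDr; apply: variation_le => // k1 k1f.
rewrite lerBrDr addrC -lerBrDr; apply: variation_le => // k2 k2f.
rewrite lerBrDr addrC -raddfD -linearD; apply: variation_ub => // x.
apply: le_trans (cmodD _ _) _; apply: le_trans (lerD (k1f x) (k2f x)) _.
rewrite -[(f * g) x]/(f x * g x) -[(f * (1 - g)) x]/(f x * (1 - g x)).
by rewrite -mulrDr addrC subrK mulr1.
Qed.

(** The factors 1, -1, ['i] and [- 'i] bound the real and the imaginary part separately, whence the
    constant 2. *)
Lemma cmod_dual_le h (k : CB) (M : R) : 0 < M -> multiplier h ->
  (forall x, cmod (k x) <= M * h x) -> cmod (sval phi k) <= M * (2 * variation h).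
Proof.
move=> M0 mh kh.
have H (a : R[i]) : cmod a = 1 -> complex.Re (a * sval phi k) <= M * variation h.
  move=> a1; pose k' : CB := ((M^-1)%:C%C * a) *: k.
  have k'h x : cmod (k' x) <= h x.
    rewrite -[k' x]/((M^-1)%:C%C * a * k x) !cmodM a1 mulr1 cmod_real.
    by rewrite ger0_norm ?invr_ge0 ?(ltW M0)// ler_pdivrMl.
  have := variation_ub mh k'h; rewrite linearZ /=.
  rewrite -[X in complex.Re X]/((M^-1)%:C%C * a * sval phi k) -mulrA.
  case: (a * _) => b c /=; rewrite mul0r subr0.
  by rewrite ler_pdivrMl.
apply: le_trans (cmod_le_ReIm _) _; rewrite mulrA mulr_natr mulrnAl mulr2n.
have i1 : cmod 'i%C = 1 :> R by rewrite /cmod normc_def/= expr0n add0r expr1n sqrtr1.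
have := H 1 (cmod1 R); rewrite mul1r.
have := H (- 1); rewrite cmodN cmod1 mulN1r raddfN => /(_ erefl).
have := H 'i%C i1; have := H (- 'i%C); rewrite cmodN i1 mulNr raddfN => /(_ erefl).
case: (sval phi k) => b c /=; rewrite !mul0r !mul1r => h1 h2 h3 h4.
by apply: lerD; rewrite ler_norml; apply/andP; split; lra.
Qed.

End Variation.

End Multipliers.

(** * Functions with translation-compact support *)

Section CompactSupport.
Context (R : realType) (G : topologicalGroupType).

(** On [K] this is compactness. Off [K], a nonzero value at [o * x] puts that point in [K], where
    the estimate for [o^-1] applies. *)
Lemma compact_support_left_ucont (phi : G -> R) (K : set G) (e : R) :
  continuous phi -> compact K -> (forall x, phi x <> 0 -> K x) -> 0 < e ->
  \forall o \near (1%g : G), forall x, `|phi (o * x)%g - phi x| <= e.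
Proof.
move=> cphi cK phiK e0; have e2 : 0 < e / 2 by lra.
have nK : \forall o \near (1%g : G), K `<=` (fun x => `|phi (o * x)%g - phi x| <= e).
  apply: (iffLR (compact_near_coveringP K) cK) => x _.
  have c1 : \forall z \near (x, 1%g : G), `|phi x - phi (z.2 * z.1)%g| < e / 2.
    have cz : continuous (fun z : G * G => (z.2 * z.1)%g).
      move=> z; apply: (@continuous_comp _ _ _ (fun v : G * G => (v.2, v.1)) (fun z => z.1 * z.2)%g);
        last exact: mulg_continuous.
      by apply: cvg_pair => /=; [exact: cvg_snd|exact: cvg_fst].
    have /cvgrPdist_lt/(_ _ e2) := cphi x.
    by rewrite -[in nbhs x](mul1g x) => /(cz (x, 1%g)).
  have c2 : \forall z \near (x, 1%g : G), `|phi x - phi z.1| < e / 2.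
    have /cvgrPdist_lt/(_ _ e2) H := cphi x.
    exists ([set y | `|phi x - phi y| < e / 2], setT); first by split=> //; exact: filterT.
    by case=> y o [].
  apply: filterS2 c1 c2 => -[y o] /= h1 h2.
  have := ler_distD (phi x) (phi (o * y)%g) (phi y).
  by rewrite (distrC (phi (o * y)%g) (phi x)); lra.
have nK' : \forall o \near (1%g : G), K `<=` (fun x => `|phi (o^-1 * x)%g - phi x| <= e).
  have := @invg_continuous G 1%g; rewrite /continuous_at invg1.
  by move=> /(_ _ nK).
apply: filterS2 nK nK' => o H1 H2 x.
have [px|px] := pselect (phi x = 0); last exact/H1/phiK.
have [pox|pox] := pselect (phi (o * x)%g = 0).
  by rewrite px pox subrr normr0 ltW.
by have := H2 _ (phiK _ pox); rewrite mulKg distrC.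
Qed.

Lemma compact_support_right_ucont (phi : G -> R) (K : set G) (e : R) :
  continuous phi -> compact K -> (forall x, phi x <> 0 -> K x) -> 0 < e ->
  \forall o \near (1%g : G), forall x, `|phi (x * o)%g - phi x| <= e.
Proof.
move=> cphi cK phiK e0.
have H : \forall o \near (1%g : G), forall x,
    `|phi (o * x)^-1%g - phi x^-1%g| <= e.
  apply: (@compact_support_left_ucont (fun x => phi x^-1%g)
    ((fun x => x^-1)%g @` K)) => //.
  - by move=> x; apply: (continuous_comp (@invg_continuous G x)); exact: cphi.
  - apply: continuous_compact => //; apply: continuous_subspaceT.
    exact: invg_continuous.
  - by move=> x /phiK Kx; exists x^-1%g => //; rewrite invgK.
have {}H : \forall o \near (1%g : G), forall x,
    `|phi (o^-1 * x)^-1%g - phi x^-1%g| <= e.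
  by have := @invg_continuous G 1%g; rewrite /continuous_at invg1 => /(_ _ H).
apply: filterS H => o Ho x; have := Ho x^-1%g.
by rewrite invgM !invgK.
Qed.

End CompactSupport.

Lemma bounded_fun_cmodP (R : realType) (T : Type) (f : T -> R[i]^o) :
  bounded_fun f <-> exists2 M : R, 0 < M & forall x, cmod (f x) <= M.
Proof.
split=> [/pinfty_ex_gt0[[M M']]|[M M0 fM]].
  rewrite ltcE/= => /andP[/eqP-> M0] fM; exists M => // x.
  by have := fM x I; rewrite /= cmodE lecR.
exists (M%:C)%C; split; first by rewrite complex_real.
move=> N MN x _; apply: le_trans (ltW MN).
by rewrite /= cmodE lecR.
Qed.

(** * Bumps, cutoffs and weak limits in a metrizable group *)

Section MetrizableGroup.
Context (R : realType) (G : topologicalGroupType) (d : G -> G -> R).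
Hypotheses (G_lc : locally_compact [set: G])
  (d0 : forall x y, d x y = 0 <-> x = y)
  (dC : forall x y, d x y = d y x)
  (dD : forall x y z, d x z <= d x y + d y z)
  (dP : forall (x : G) (A : set G),
    nbhs x A <-> exists2 r : R, 0 < r & [set y | d x y < r] `<=` A).
Local Notation C := (R[i]^o).
Local Notation CB := (bcontType R G).

Let hG : hausdorff_space G.
Proof. exact: dist_hausdorff d0 dC dD dP. Qed.

Lemma dist_bump (x : G) (O : set G) : nbhs x O -> exists r (phi : G -> R),
  [/\ 0 < r, multiplier phi, forall y, d x y <= r -> phi y = 1,
      forall y, phi y <> 0 -> d x y < r *+ 2 &
      [set y | d x y < r *+ 2] `<=` O].
Proof.
move=> /dP[r r0 rO]; have r2 : 0 < r / 2 by lra.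
exists (r / 2), (fun y => Num.min 1 (Num.max 0 (2 - d x y / (r / 2)))).
split=> //.
- split=> y.
    apply: (@continuous_min R G (fun=> 1)
      (fun y => Num.max 0 (2 - d x y / (r / 2))) y); first exact: cvg_cst.
    apply: (@continuous_max R G (fun=> 0)
      (fun y => 2 - d x y / (r / 2)) y); first exact: cvg_cst.
    apply: (@cvgB _ R^o); first exact: cvg_cst.
    by apply: cvgMr_tmp; exact: (dist_continuous dC dD dP).
  by rewrite le_min ler01 le_max lexx/= ge_min lexx.
- move=> y xy; apply/min_idPl; rewrite le_max; apply/orP; right.
  have : d x y / (r / 2) <= 1 by rewrite ler_pdivrMr// mul1r.
  lra.
- move=> y; have [//|ry] := ltP (d x y) ((r / 2) *+ 2).
  case; rewrite (_ : Num.max _ _ = 0) ?minr_r//; first exact/min_idPr.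
  apply/max_idPl; rewrite subr_le0 ler_pdivlMr//.
  by rewrite mulr_natl.
- by move=> y /= xy; apply: rO; rewrite /= (splitr r) -mulr2n.
Qed.

Lemma compact_nbhs (x : G) : exists2 K, nbhs x K & compact K /\ closed K.
Proof.
have [K xK cK] := G_lc (I : [set: G] x); exists K => //.
by apply: filterS (xK : nbhs x [set y | [set: G] y -> K y]) => y; exact.
Qed.

(** Compactness in filter form: the sets [A] for which some cutoff vanishes on [closure D] minus [A]
    form a filter, proper if the claim fails. At a cluster point, one minus a bump shows that the
    complement of a ball belongs to it, a contradiction. *)
Lemma cutoff_exists (D : set G) : precompact D ->
  exists2 p : G -> R, cutoff p & forall x, D x -> p x = 0.
Proof.
rewrite precompactE => cD.
pose Z (A : set G) := exists2 p : G -> R, cutoff p & forall x, A x -> p x = 0.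
suff [p cp pD] : Z (closure D).
  by exists p => // x Dx; apply: pD; exact: subset_closure.
apply: contrapT => nZ.
have ZS A B : A `<=` B -> Z B -> Z A.
  by move=> AB [p cp pB]; exists p => // x /AB; exact: pB.
pose F : set_system G := [set A | Z (closure D `\` A)].
have FF : ProperFilter F.
  apply: Build_ProperFilter_ex.
    move=> A ZA; apply: contrapT => nA; apply: nZ; apply: ZS ZA => x Dx.
    by split=> // Ax; apply: nA; exists x.
  split; rewrite /F/=.
  - by exists 1; [exact: cutoff1|move=> x [? []]].
  - move=> A B [p cp pA] [q cq qB]; exists (p * q); first exact: cutoffM.
    move=> x [Dx nAB]; rewrite -[(p * q) x]/(p x * q x).
    have [Ax|nAx] := pselect (A x); last by rewrite pA ?mul0r.
    by rewrite qB ?mulr0//; split=> // Bx; apply: nAB.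
  - by move=> A B AB; apply: ZS => x [Dx nBx]; split=> // /AB.
have FD : F (closure D).
  by rewrite /F/=; exists 1 => [|x []//]; exact: cutoff1.
have [x [Dx Fx]] := cD F FF FD.
have [K xK [cK clK]] := compact_nbhs x.
have [r [phi [r0 mphi phi1 phi0 rK]]] := dist_bump xK.
have nB : nbhs x [set y | d x y < r] by exact: dist_ball_nbhs.
have [|y [/= nxy xy]] := Fx (~` [set y | d x y < r]) _ _ nB.
  exists (1 - phi) => [|y [_ /contrapT/= xy]]; last first.
    by rewrite -[(1 - phi) y]/(1 - phi y) phi1 ?subrr// ltW.
  split; first exact: multiplierC.
  exists K => // y /= phiy; apply: rK; apply: phi0 => phiy0; apply: phiy.
  by rewrite -[(1 - phi) y]/(1 - phi y) phiy0 subr0.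
exact: nxy.
Qed.

Lemma nonprecompact_range (W : set G) (s : nat -> G) : nbhs (1%g : G) W ->
  (forall m n, (m < n)%N -> ~ W ((s m)^-1 * s n)%g) -> ~ precompact (range s).
Proof.
move=> /nbhs1_div[V nV VW] sW [K sK [cK _]].
have [|p [Kp pcl]] := cK (s @ \oo) _.
  by apply: (@filterE _ \oo) => n; apply: sK; exists n.
pose O := [set x : G | V (p^-1 * x)%g].
have nO : nbhs p O.
  apply: (@mulg_continuousr G p^-1%g p V).
  by rewrite mulVg.
have often N : exists2 n, (N <= n)%N & O (s n).
  have [|_ [[n Nn <-] On]] := pcl (s @` [set n | (N <= n)%N]) O _ nO.
    by exists N => // n Nn; exists n.
  by exists n.
have [m _ Om] := often 0.
have [n mn On] := often m.+1.
apply: (sW m n mn); have := VW _ _ On Om.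
by rewrite invgM invgK mulgA mulgK.
Qed.

Lemma finite_range_bound (s : nat -> G) (F : set G) : finite_set F ->
  F `<=` range s -> exists n, forall b, F b -> exists2 i, (i < n)%N & s i = b.
Proof.
move=> /finite_set_In[l lF] Fs.
have {Fs} : forall b, List.In b l -> range s b by move=> b /lF; exact: Fs.
suff H : (forall b, List.In b l -> range s b) -> exists n, forall b, List.In b l ->
    exists2 i, (i < n)%N & s i = b.
  by move=> /H[n nP]; exists n => b /lF; exact: nP.
elim: l {lF} => [|a l IH] H; first by exists 0%N.
have [n nP] := IH (fun b bl => H b (or_intror bl)).
have [i _ ia] := H a (or_introl erefl).
exists (maxn n i.+1) => b [<-|/nP[j jn jb]]; first by exists i => //; rewrite leq_max ltnSn orbT.
by exists j => //; rewrite leq_max jn.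
Qed.

Lemma cvg_divg (y : G) : (x * y^-1)%g @[x --> y] --> (1%g : G).
Proof. by rewrite -(mulgV y); exact: mulg_continuousl. Qed.

Lemma cvg_ldivg (y : G) : (y^-1 * x)%g @[x --> y] --> (1%g : G).
Proof. by rewrite -(mulVg y); exact: mulg_continuousr. Qed.

Definition left_ucont (f : G -> C) := forall e : R, 0 < e ->
  \forall o \near (1%g : G), forall x, cmod (f (o * x)%g - f x) <= e.

Definition right_ucont (f : G -> C) := forall e : R, 0 < e ->
  \forall o \near (1%g : G), forall x, cmod (f (x * o)%g - f x) <= e.

Lemma precompact_translate (a : G) (W : set G) : precompact W ->
  precompact [set (a * w)%g | w in W].
Proof.
move=> /(precompactP _ hG)[K cK WK]; apply/(precompactP _ hG).
exists ((fun w => a * w)%g @` K); last by move=> _ [w /WK Kw <-]; exists w.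
apply: continuous_compact => //; apply: continuous_subspaceT.
exact: mulg_continuousr.
Qed.

Section Extension.
Context (f : CB) (S : set G).
Hypotheses (fS : forall x, f x <> 0 -> S x) (tcS : translation_compact S)
  (fl : left_ucont f) (fr : right_ucont f).

Section AtInfinity.
Context (U : set_system G) (UU : UltraFilter U).
Hypothesis Uinf : forall K : set G, precompact K -> ~ U K.

(** Right uniform continuity makes the limit continuous. If its support were not precompact, left
    translation-compactness would give finitely many points [b] of it with the intersection of the
    [S b^-1] precompact; but that intersection belongs to [U]. *)
Lemma pointwise_limit : exists g : CB,
  (forall x, (f (s * x)%g : C) @[s --> U] --> (g x : C)) /\
  precompact [set x | g x <> 0].
Proof.
have [M M0 fM] := bcont_bounded f.
have /choice[g0 g0P] x : exists l : C, (f (s * x)%g : C) @[s --> U] --> l.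
  by apply/cvg_ex; apply: (@ultra_bounded_cvgC _ _ _ _ M) => s; exact: fM.
have cg0 : continuous g0.
  move=> x; apply/cvgC_cmodP => e e0; have e2 : 0 < e / 2 by lra.
  have nx : \forall y \near x, forall z,
      cmod (f (z * (x^-1 * y))%g - f z) <= e / 2 := @cvg_ldivg x _ (fr e2).
  apply: filterS nx => y /= H.
  apply: le_lt_trans (_ : e / 2 < e); last by lra.
  have := cvgC_le (c := 0) (cvgB (g0P y) (g0P x)) (e := e / 2).
  rewrite subr0; apply; apply: filterE => s; rewrite subr0.
  by have := H (s * x)%g; rewrite -mulgA mulVKg.
have g0M x : cmod (g0 x) <= M.
  have := cvgC_le (c := 0) (g0P x) (e := M).
  by rewrite subr0; apply; apply: filterE => s; rewrite subr0; exact: fM.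
have [g gE] := bcont_exists cg0 g0M.
exists g; split=> [x|]; first by rewrite gE.
apply: contrapT => /(tcS.2)[F [finF Fg pF]].
apply: (Uinf pF).
have [l lF] := finite_set_In finF.
have : \forall s \near U, forall b, List.In b l -> S (s * b)%g.
  apply: near_In => b /lF/Fg/= gb.
  have e0 : 0 < cmod (g0 b).
    rewrite lt_neqAle cmod_ge0 andbT eq_sym; apply/eqP => /cmod_eq0 e.
    by apply: gb; rewrite gE.
  have /cvgC_cmodP/(_ _ e0) := g0P b; apply: filterS => s H.
  by apply: fS => fs0; move: H; rewrite fs0 sub0r cmodN ltxx.
apply: filterS => s H b /lF/H Ssb.
exists (s * b)%g => //; exists b^-1%g => //.
by rewrite mulgK.
Qed.

Lemma locally_uniform_limit (g : CB) (p : G -> R) (e : R) : cutoff p -> 0 < e ->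
  (forall x, (f (s * x)%g : C) @[s --> U] --> (g x : C)) ->
  \forall s \near U, forall x, cmod ((1 - p x)%:C%C * (f (s * x)%g - g x)) <= e.
Proof.
move=> [[_ p01] cp] e0 Ug.
have e3 : 0 < e / 3 by lra.
pose K := closure [set x | p x <> 1].
have cK : compact K by move: cp; rewrite precompactE.
have : \forall s \near U, K `<=` (fun x => cmod (f (s * x)%g - g x) <= e).
  apply: (iffLR (compact_near_coveringP K) cK) => x _.
  have /cvgC_cmodP/(_ _ e3) H1 := Ug x.
  have H2 : \forall y \near x, forall z,
      cmod (f (z * (x^-1 * y))%g - f z) <= e / 3 := @cvg_ldivg x _ (fr e3).
  have /cvgC_cmodP/(_ _ e3) H3 := @bcont_continuous _ _ g x.
  exists ([set y | (forall z, cmod (f (z * (x^-1 * y))%g - f z) <= e / 3) /\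
      cmod (g y - g x) < e / 3], [set s | cmod (f (s * x)%g - g x) < e / 3]).
    by split=> //; exact: filterI.
  move=> [y s] /= [[Hy gy] Hs].
  apply: le_trans (cmod_tri (f (s * x)%g) _ _) _.
  have := Hy (s * x)%g; rewrite -mulgA mulVKg => Hyx.
  have := cmod_tri (g x) (f (s * x)%g) (g y).
  by rewrite (cmodB (g x)); lra.
apply: filterS => s Hs x.
rewrite cmodM cmod_real; have /andP[p0 p1] := p01 x.
rewrite ger0_norm ?subr_ge0//.
have [->|px] := pselect (p x = 1); first by rewrite subrr mul0r ltW.
have Kx : K x by exact: subset_closure.
rewrite -[leRHS]mul1r ler_pM ?cmod_ge0 ?subr_ge0//; first by lra.
exact: Hs.
Qed.

Lemma weak_limit_at_infinity : exists g : CB, forall phi : dual CB,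
  sval phi (left_translate s f) @[s --> U] --> (sval phi g : C).
Proof.
have [g [Ug pQ]] := pointwise_limit; exists g => phi; apply/cvgC_cmodP => e e0.
apply: contrapT => nU.
have bad : \forall s \near U, e <= cmod (sval phi (left_translate s f) - sval phi g).
  by apply: filterS (ultra_notP UU nU) => s /negP; rewrite -leNgt.
have [M M0 fM] := bcont_bounded f.
have [B varB] := variation_bounded phi.
pose u (s : G) : G -> R := fun x => cmod (f (s * x)%g) / M.
have mu s : multiplier (u s).
  split=> [x|x]; last first.
    by rewrite divr_ge0 ?cmod_ge0 ?(ltW M0)//= ler_pdivrMr// mul1r fM.
  suff cu : cmod (f (s * y)%g) @[y --> x] --> cmod (f (s * x)%g) by exact: cvgMr_tmp.
  apply/cvgrPdist_lt => r r0.
  have /cvgC_cmodP/(_ _ r0) := @bcont_continuous _ _ (left_translate s f) x.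
  apply: filterS => y; apply: le_lt_trans.
  by rewrite distrC; exact: cmod_dist.
have vM := @variation_split R G phi; have vge0 := @variation_ge0 R G phi.
have mM := @multiplierM R G; have mC := @multiplierC R G.
have cut_mult (p : G -> R) : cutoff p -> multiplier p by case.
pose heavy := heavy (@multiplier R G) (@cutoff R G) (variation phi) U u.
have heavy1 : heavy 1.
  split; first exact: multiplier1.
  (* Half of [e] is lost to the locally uniform error; the factor [2 * M] in [cmod_dual_le] gives
     the rest of the constant. *)
  exists (e / (4 * M)) => [|p cp]; first by rewrite divr_gt0// mulr_gt0.
  have [mp _] := cp; rewrite mul1r.
  apply: (le_nu UU mM vge0 varB mu) => //.
  (* The cutoff [p0] kills [g], so [f_s - g] differs from [p * p0] times [f_s] only by [1 - p * p0]
     times [f_s - g], which is uniformly small. *)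
  have [p0 cp0 p0Q] := cutoff_exists pQ.
  have [mp0 _] := cp0; have mpp0 := multiplierM mp mp0.
  have [b b0 phib] := dual_bound phi.
  have eta0 : 0 < e / (2 * b) by rewrite divr_gt0// mulr_gt0.
  have cpp0 := cutoffM cp cp0.
  have small := locally_uniform_limit cpp0 eta0 Ug.
  apply: filterS2 bad small => s es Hs.
  have [k kE] := bcont_mul (left_translate s f) mpp0.
  pose w : CB := left_translate s f - g - k.
  have wE x : w x = (1 - (p * p0) x)%:C%C * (f (s * x)%g - g x).
    rewrite -[w x]/(f (s * x)%g - g x - k x) kE /=.
    have pg : ((p * p0) x)%:C%C * (g x : R[i]) = 0.
      have [->|gx] := pselect (g x = 0); first by rewrite mulr0.
      by rewrite -[(p * p0) x]/(p x * p0 x) p0Q// mulr0 mul0r.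
    by rewrite rmorphB rmorph1 mulrBl mul1r mulrBr pg subr0 mulrC.
  have phiw : cmod (sval phi w) <= e / 2.
    have -> : e / 2 = b * (e / (2 * b)) by field; rewrite gt_eqF.
    by apply: phib => // x; rewrite wE; exact: Hs.
  have phik : e / 2 <= cmod (sval phi k).
    have := cmodD (sval phi w) (sval phi k).
    by rewrite -linearD subrK linearB; lra.
  have mpu : multiplier (p * u s) := multiplierM mp (mu s).
  have mpup0 : multiplier (p * u s * p0) := multiplierM mpu mp0.
  have kM x : cmod (k x) <= M * (p * u s * p0) x.
    rewrite kE cmodM cmod_real ger0_norm; last by have /andP[] := mpp0.2 x.
    rewrite -[(p * u s * p0) x]/(p x * (cmod (f (s * x)%g) / M) * p0 x).
    rewrite -[(p * p0) x]/(p x * p0 x) /=.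
    rewrite [leRHS](_ : _ = cmod (f (s * x)%g) * (p x * p0 x))//.
    by field; rewrite gt_eqF.
  apply: le_trans (mu_mul_le mM mC vge0 vM mpu mp0).
  have := le_trans phik (cmod_dual_le phi M0 mpup0 kM).
  set v := variation _ _ => ev; rewrite ler_pdivrMr ?mulr_gt0//.
  by rewrite (_ : v * (4 * M) = 2 * (M * (2 * v))); [lra|ring].
(* Keeping each new point outside the precompact translates of [W] by the older ones makes the range
   of the sequence non-precompact. *)
have [W nW pW] : exists2 W, nbhs (1%g : G) W & precompact W.
  have [W nW [cW clW]] := compact_nbhs 1%g.
  by exists W => //; exists W.
pose prod (l : seq G) : G -> R := foldr (fun s h => h * u s) 1 l.
pose good l := heavy (prod l).
pose P (l : seq G) s := forall a, List.In a l -> ~ W (a^-1 * s)%g.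
have [//|l gl|s sP] := @dependent_choice_history _ good P.
  have UP : U (P l).
    apply: near_In => a _; apply: ultra_notP.
    apply: Uinf; apply: precompact_subset (precompact_translate a pW) => s Ws.
    by exists (a^-1 * s)%g => //; rewrite mulVKg.
  have [a Pa ga] := heavy_step UU mM mC vge0 varB vM mu cut_mult
    (@cutoff1 R G) (@cutoffM R G) gl UP.
  by exists a.
have nL : ~ precompact (range s).
  apply: (nonprecompact_range nW) => m n mn.
  by have [_] := sP n; apply; exact: in_history.
have [F [finF FL pD]] := tcS.1 _ nL.
have [n nF] := finite_range_bound finF FL.
have [p cp pD0] := cutoff_exists pD.
have [[_ [c c0 cH]] _] := sP n.
have := cH p cp.
(* The cutoff vanishes on the intersection supplied by right translation-compactness, and off it
   some factor of the product vanishes. *)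
have -> : prod (rev (mkseq s n)) * p = 0.
  apply/funext => x; rewrite -[LHS]/(prod (rev (mkseq s n)) x * p x).
  have [Dx|nDx] := pselect ((\bigcap_(b in F) mulset [set b^-1%g] S) x).
    by rewrite pD0// mulr0.
  suff -> : prod (rev (mkseq s n)) x = 0 by rewrite mul0r.
  apply: contrapT => px; apply: nDx => b Fb.
  have [i ni <-] := nF b Fb.
  exists (s i)^-1%g => //; exists (s i * x)%g; last by rewrite mulKg.
  apply: fS => fx0; apply: px.
  elim: n ni {nF sP cH} => // n IH; rewrite ltnS mkseqS rev_rcons => ni.
  rewrite -[prod _ x]/(prod (rev (mkseq s n)) x * u (s n) x).
  have [<-|ine] := eqVneq i n; first by rewrite /u fx0 cmod0 mul0r mulr0.
  by rewrite IH ?mul0r// ltn_neqAle ine.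
have m0 : multiplier (0 : G -> R).
  by split=> [x|x]; [exact: (@cst_continuous G R 0 x)|rewrite lexx ler01].
(* At zero the splitting reads [nu 0 = nu 0 + nu 0], so the heavy product would have no mass. *)
have := nu_split UU mM mC vge0 varB vM mu m0 m0; rewrite !mul0r.
by lra.
Qed.

End AtInfinity.

Theorem translation_compact_support_WAP : WAP f.
Proof.
apply: weak_cvg_WAP => U UU.
have [[K [pK UK]]|nK] := pselect (exists K, precompact K /\ U K); last first.
  by apply: weak_limit_at_infinity => K pK UK; apply: nK; exists K.
move: pK; rewrite precompactE compact_ultra => /(_ U UU)[|s0 [_ Us0]].
  by apply: filterS UK; exact: subset_closure.
exists (left_translate s0 f) => phi; apply/cvgC_cmodP => e e0.
have [b b0 phib] := dual_bound phi.
have eta0 : 0 < e / (2 * b) by rewrite divr_gt0// mulr_gt0.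
have : \forall s \near s0, forall x,
  cmod (f (s * s0^-1 * x)%g - f x) <= e / (2 * b) := @cvg_divg s0 _ (fl eta0).
move=> /Us0; apply: filterS => s Hs.
rewrite -linearB; apply: le_lt_trans (_ : e / 2 < e); last by lra.
have -> : e / 2 = b * (e / (2 * b)) by field; rewrite gt_eqF.
apply: phib => // x; have := Hs (s0 * x)%g.
by rewrite mulgA mulgVK.
Qed.

End Extension.

(** * Sums of bumps along an E-set *)

Section BumpSum.
Context (T V W K : set G) (phi : G -> R).
Hypotheses (T_E : E_set T) (VT : right_uniformly_discrete V T)
  (tcVT : translation_compact (mulset V T))
  (nW : nbhs (1%g : G) W) (WV : forall a b, W a -> W b -> V (a * b)%g)
  (Winv : forall a, W a -> W a^-1%g)
  (cK : compact K) (mphi : multiplier phi)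
  (phiK : forall x, phi x <> 0 -> K x) (phiW : forall x, phi x <> 0 -> W x).

Lemma bump_sum_WAP (c : G -> C) (M : R) : 0 < M -> (forall x, cmod (c x) <= M) ->
  exists2 g : CB, WAP g &
    (forall x t, T t -> V (x * t^-1)%g -> g x = c t * (phi (x * t^-1)%g)%:C%C) /\
    (forall x, g x <> 0 -> exists t, [/\ T t, c t <> 0 & phi (x * t^-1)%g <> 0]).
Proof.
move=> M0 cM.
(* Right uniform discreteness makes the selected [t] unique; the test in [f] screens out the default
   [1%g]. *)
pose sel x := xget 1%g [set t | T t /\ V (x * t^-1)%g].
pose f x : C := if `[<T (sel x) /\ V (x * (sel x)^-1)%g>]
  then c (sel x) * (phi (x * (sel x)^-1)%g)%:C%C else 0.
have selE x t : T t -> V (x * t^-1)%g -> sel x = t.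
  move=> Tt Vt; rewrite /sel; case: xgetP => [s _ [Ts Vs]|/(_ t)[]//].
  apply: contrapT => st; have : set0 x by rewrite -(VT Ts Tt st); split;
    [exists (x * s^-1)%g => //; exists s|exists (x * t^-1)%g => //; exists t];
    rewrite ?mulgVK.
  by [].
have fE x t : T t -> V (x * t^-1)%g -> f x = c t * (phi (x * t^-1)%g)%:C%C.
  move=> Tt Vt; have e := selE _ _ Tt Vt; rewrite /f e.
  by case: asboolP => // -[].
have fsupp x : f x <> 0 -> exists t, [/\ T t, c t <> 0 & phi (x * t^-1)%g <> 0].
  rewrite /f; case: asboolP => // -[Ts Vs] cphi; exists (sel x); split=> //.
    by move=> c0; apply: cphi; rewrite c0 mul0r.
  by move=> p0; apply: cphi; rewrite p0 mulr0.
have [cphi p01] := mphi.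
have W1 : W 1%g := nbhs_singleton nW.
have WsubV a : W a -> V a by move=> Wa; rewrite -(mulg1 a); exact: WV.
have close e x y t : 0 < e -> T t -> V (x * t^-1)%g -> V (y * t^-1)%g ->
    `|phi (y * t^-1)%g - phi (x * t^-1)%g| <= e / M -> cmod (f y - f x) <= e.
  move=> e0 Tt Vx Vy pe; rewrite (fE x t)// (fE y t)// -mulrBr -rmorphB.
  rewrite cmodM cmod_real (_ : e = M * (e / M)); last by field; rewrite gt_eqF.
  exact: ler_pM (cmod_ge0 _) (normr_ge0 _) (cM t) pe.
have fl : left_ucont f.
  move=> e e0; have eM : 0 < e / M by rewrite divr_gt0.
  have H := compact_support_left_ucont cphi cK phiK eM.
  apply: filterS2 nW H => o Wo Ho x.
  have [fx|/fsupp[t [Tt _ /phiW Wx]]] := pselect (f x = 0).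
    have [fox|/fsupp[t [Tt _ /phiW Wox]]] := pselect (f (o * x)%g = 0).
      by rewrite fx fox subrr cmod0 ltW.
    apply: (close _ _ _ t) => //.
    - by have := WV (Winv Wo) Wox; rewrite !mulgA mulVg mul1g.
    - exact: WsubV.
    - by rewrite -mulgA.
  apply: (close _ _ _ t) => //.
  - exact: WsubV.
  - by rewrite -mulgA; exact: WV.
  - by rewrite -mulgA.
have fr : right_ucont f.
  move=> e e0; have eM : 0 < e / M by rewrite divr_gt0.
  have H := compact_support_right_ucont cphi cK phiK eM.
  have nWH : nbhs (1%g : G) (W `&` [set o | forall y,
      `|phi (y * o)%g - phi y| <= e / M]) by exact: filterI.
  apply: filterS (T_E.2 _ nWH) => o Ho x.
  (* The E-set condition: moving [x] by [o] on the right moves [x * t^-1] by the conjugate of [o] by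
     [t], which is small uniformly over [T]. *)
  have {}Ho t : T t -> W (t * o * t^-1)%g /\
      forall y, `|phi (y * (t * o * t^-1))%g - phi y| <= e / M.
    move=> Tt; have [_ -> [_ [n [Wn Hn] [_ -> <-]] <-]] := Ho t (or_introl Tt).
    by rewrite mulgA mulgV mul1g mulgK.
  have xo t : (x * o * t^-1 = (x * t^-1) * (t * o * t^-1))%g.
    by rewrite !mulgA mulgVK.
  have [fx|/fsupp[t [Tt _ /phiW Wx]]] := pselect (f x = 0).
    have [fox|/fsupp[t [Tt _ /phiW Wox]]] := pselect (f (x * o)%g = 0).
      by rewrite fx fox subrr cmod0 ltW.
    have [Wo Hy] := Ho t Tt.
    apply: (close _ _ _ t) => //.
    - have := WV Wox (Winv Wo).
      by rewrite xo -mulgA mulgV mulg1.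
    - exact: WsubV.
    - by rewrite xo.
  have [Wo Hy] := Ho t Tt.
  apply: (close _ _ _ t) => //.
  - exact: WsubV.
  - by rewrite xo; exact: WV.
  - by rewrite xo.
have cf : continuous f.
  move=> x; apply/cvgC_cmodP => e e0; have e2 : 0 < e / 2 by lra.
  have nx : \forall y \near x, forall z,
      cmod (f (y * x^-1 * z)%g - f z) <= e / 2 := @cvg_divg x _ (fl _ e2).
  apply: filterS nx => y /(_ x); rewrite mulgVK.
  by move=> H; apply: le_lt_trans H _; lra.
have fM x : cmod (f x) <= M.
  rewrite /f; case: asboolP => _; last by rewrite cmod0 ltW.
  rewrite cmodM cmod_real -[leRHS]mulr1.
  have /andP[q0 q1] := p01 (x * (sel x)^-1)%g.
  by apply: ler_pM (cmod_ge0 _) (normr_ge0 _) (cM _) _; rewrite ger0_norm.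
have [g gE] := bcont_exists cf fM.
have gfE : (g : G -> C) = f by apply/funext.
exists g; last by split=> x; rewrite gE; [exact: fE|exact: fsupp].
apply: (@translation_compact_support_WAP g (mulset V T)) => //.
- move=> x; rewrite gE => /fsupp[t [Tt _ /phiW Wx]].
  by exists (x * t^-1)%g; [exact: WsubV|exists t => //; rewrite mulgVK].
- by rewrite gfE.
- by rewrite gfE.
Qed.

End BumpSum.

(** * The two implications *)

Lemma approximable_discrete_translation_compact (T : set G) :
  approximable_WAP_interpolation_set R T -> exists V : set G,
    [/\ nbhs (1%g : G) V, right_uniformly_discrete V T &
        translation_compact (mulset V T)].
Proof.
move=> [interp approx].
have iT : @WAP_interpolation R G T.
  move=> c M cM.
  have [|g Wg gE] := interp (fun t => c (val t)).
    apply/bounded_fun_cmodP; exists (`|M| + 1); first by rewrite ltr_wpDl.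
    by move=> t; rewrite (le_trans (cM _))// (le_trans (ler_norm _))// lerDl.
  by exists g => // t Tt; exact: (gE (SigSub (mem_set Tt))).
have [V nV VT] := interpolation_right_uniformly_discrete dP iT.
have [K nK [cK _]] := compact_nbhs 1%g.
have [V1 [V2 [[oV1 V11] _ clV V2K H]]] := approx K nK.
have nV1 : nbhs (1%g : G) V1 by apply: open_nbhs_nbhs.
have V12 : V1 `<=` V2 by apply: subset_trans clV; exact: subset_closure.
have [tcr tcl] := approximable_translation_compact hG cK V12 V2K H.
(* Right uniform discreteness and translation-compactness both pass to smaller neighbourhoods. *)
exists (V `&` V1); split; first exact: filterI.
  move=> s s' Ts Ts' ss'; rewrite -subset0 -(VT _ _ Ts Ts' ss').
  by move=> x [[v [Vv _] vs] [v' [Vv' _] vs']]; split; [exists v|exists v'].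
have sub : mulset (V `&` V1) T `<=` mulset V1 T.
  by move=> x [v [_ Vv] vt]; exists v.
split=> L nL;
  [have [F [finF FL pF]] := tcr L nL|have [F [finF FL pF]] := tcl L nL];
  exists F; split=> //; apply: precompact_subset pF => x Fx b Fb.
  by have [y -> [z /sub Sz e]] := Fx b Fb; exists b^-1%g => //; exists z.
by have [z /sub Sz e] := Fx b Fb; exists z.
Qed.

Lemma discrete_translation_compact_approximable (T V : set G) : E_set T ->
  nbhs (1%g : G) V -> right_uniformly_discrete V T ->
  translation_compact (mulset V T) -> approximable_WAP_interpolation_set R T.
Proof.
move=> T_E nV VT tcVT.
have [V0 nV0 V0V] := nbhs1_div nV.
pose W := V0 `&` [set x | V0 x^-1%g].
have nV0' : nbhs (1%g : G) [set x | V0 x^-1%g].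
  by have := @invg_continuous G 1%g; rewrite /continuous_at invg1 => /(_ _ nV0).
have nW : nbhs (1%g : G) W by exact: filterI.
have Winv a : W a -> W a^-1%g by move=> [Va Va']; split=> //=; rewrite invgK.
have WV a b : W a -> W b -> V (a * b)%g.
  by move=> [_ Va'] [Vb _]; have := V0V _ _ Vb Va'; rewrite invgK.
have W1 : W 1%g := nbhs_singleton nW.
have WsubV a : W a -> V a by move=> Wa; rewrite -(mulg1 a); exact: WV.
have [K nK [cK _]] := compact_nbhs 1%g.
have bump (N : set G) : nbhs (1%g : G) N -> exists r (phi : G -> R),
    [/\ 0 < r, forall y, d 1%g y <= r -> phi y = 1,
      forall y, phi y <> 0 -> d 1%g y < r *+ 2,
      [set y | d 1%g y < r *+ 2] `<=` N `&` W &
      forall (c : G -> C) (M : R), 0 < M -> (forall x, cmod (c x) <= M) ->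
        exists2 g : CB, WAP g &
        (forall x t, T t -> V (x * t^-1)%g -> g x = c t * (phi (x * t^-1)%g)%:C%C) /\
        (forall x, g x <> 0 -> exists t, [/\ T t, c t <> 0 & phi (x * t^-1)%g <> 0])].
  move=> nN; have nO : nbhs (1%g : G) ((N `&` W) `&` K).
    by apply: filterI => //; exact: filterI.
  have [r [phi [r0 mphi phi1 phi0 rO]]] := dist_bump nO.
  exists r, phi; split=> // [y /rO[]//|c M].
  have phiNWK x : phi x <> 0 -> N x /\ W x /\ K x by move=> /phi0/rO[[]].
  by apply: (bump_sum_WAP T_E VT tcVT nW WV Winv cK mphi);
    move=> x /phiNWK[_ []].
split=> [f /bounded_fun_cmodP[M M0 fM]|N nN].
  have [r [phi [r0 phi1 _ _ gP]]] := bump setT filterT.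
  pose c x : C := oapp f 0 (insub x).
  have cM x : cmod (c x) <= M.
    by rewrite /c; case: insubP => [t _ _|_] /=; [exact: fM|rewrite cmod0 ltW].
  have [g Wg [gE _]] := gP c M M0 cM.
  exists g => // t; have Tt : T (val t) := set_mem (valP t).
  rewrite (gE _ _ Tt) mulgV; last exact: WsubV.
  by rewrite phi1 ?(iffRL (d0 _ _) erefl) ?ltW// mulr1 /c valK.
have [r [phi [r0 phi1 phi0 rNW gP]]] := bump N nN.
have r2 : r < r *+ 2 by rewrite mulr2n ltrDl.
have openB e : open [set y | d 1%g y < e].
  have /continuousP := @dist_continuous R G d dC dD dP 1%g.
  by move=> /(_ _ (@open_lt R e)).
have d11 : d 1%g 1%g = 0 by apply/d0.
(* The bump is 1 on the first ball and vanishes off the second; the closed ball of radius [r] lies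
   between them. *)
exists [set y | d 1%g y < r], [set y | d 1%g y < r *+ 2]; split.
- by split; [exact: openB|rewrite /= d11].
- by split; [exact: openB|rewrite /= d11 mulrn_wgt0].
- have clB : closed [set y | d 1%g y <= r].
    have /continuous_closedP := @dist_continuous R G d dC dD dP 1%g.
    by move=> /(_ _ (@closed_le R r)).
  move=> x clx; apply: le_lt_trans r2.
  suff : closure [set y | d 1%g y <= r] x by rewrite -(iffLR (closure_id _) clB).
  by apply: closureS clx => y /= /ltW.
- by move=> x /rNW[].
- move=> T1 T1T.
  have [|h Wh [hE hsupp]] := gP (fun x => if `[<T1 x>] then 1 else 0) 1 ltr01.
    by move=> x; case: asboolP => _; rewrite ?cmod0 ?cmod1.
  exists h; split=> //.
    move=> _ [_ [v /= rv [t Tt <-]] <-]; rewrite (hE _ t); last 2 first.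
    + exact: T1T.
    + by rewrite mulgK; apply: WsubV; have /rNW[] : d 1%g v < r *+ 2 by exact: lt_trans r2.
    by rewrite mulgK phi1 ?ltW// mulr1; case: asboolP.
  move=> _ [x nx <-]; apply: contrapT => /= /hsupp[t [Tt]].
  case: asboolP => // T1t _ /phi0 dt; apply: nx.
  by exists (x * t^-1)%g => //; exists t => //; rewrite mulgVK.
Qed.

End MetrizableGroup.

Theorem corollary4p18 (R : realType) (G : topologicalGroupType)
    (G_lc : locally_compact [set: G]) (G_metr : metrizable R G)
    (G_E : E_group G) (T : set G) (T_E : E_set T) :
  approximable_WAP_interpolation_set R T <->
  exists V : set G,
    [/\ nbhs (1%g : G) V,
        right_uniformly_discrete V T &
        translation_compact (mulset V T)].
Proof.
have [d [d0 dC dD dP]] := G_metr; split.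
  exact: (approximable_discrete_translation_compact G_lc d0 dC dD dP).
move=> [V [nV VT tcVT]].
exact: (discrete_translation_compact_approximable G_lc d0 dC dD dP T_E nV VT tcVT).
Qed.
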